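(* Let $h>0$ and let $D_m(h\beta)$, $\beta\in\mathbb{Z}$, be the discrete analogue of the differential operator $\frac{d^{2m}}{dx^{2m}}-\frac{d^{2m-2}}{dx^{2m-2}}$, given by the explicit formula in the context. When $m=1,2,3$, it satisfies the following equalities (for $\beta\in\mathbb{Z}$): 1) $D_m(h\beta)*e^{h\beta}=0$; 2) $D_m(h\beta)*e^{-h\beta}=0$; 3) $D_m(h\beta)*(h\beta)^n=0$ for integers $0\le n\le 2m-3$; i.e. the convolution of $D_m(h\beta)$ with a polynomial of degree $\le 2m-3$, when $m=2,3$, is equal to zero; 4) $D_m(h\beta)*\psi_m(h\beta)=\delta(h\beta)$, where $$\psi_m(x)=\frac{\operatorname{sign} x}{2}\left(\frac{e^x-e^{-x}}{2}-\sum_{k=1}^{m-1}\frac{x^{2k-1}}{(2k-1)!}\right)$$ and $\delta(h\beta)=1$ for $\beta=0$, $\delta(h\beta)=0$ for $\beta\ne 0$.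
   Context: Convolution. The convolution of two real-valued functions $\varphi(h\beta),\psi(h\beta)$ of the discrete argument $\beta\in\mathbb{Z}$ is $$\varphi(h\beta)*\psi(h\beta)=\sum_{\gamma=-\infty}^{\infty}\varphi(h\gamma)\,\psi(h\beta-h\gamma),$$ a series understood in the sense of absolute convergence. Here $\operatorname{sign}x$ is the usual sign function, so that $\psi_m(0)=0$. Sums over an empty index range are zero. The function $\psi_m$ is a solution of $\left(\frac{d^{2m}}{dx^{2m}}-\frac{d^{2m-2}}{dx^{2m-2}}\right)\psi(x)=\delta(x)$, with $\delta(x)$ on the right the Dirac delta function. Euler polynomials. For an integer $k\ge 0$, $$E_k(\lambda)=\frac{(1-\lambda)^{k+2}}{\lambda}D^k\frac{\lambda}{(1-\lambda)^2},\qquad D=\lambda\frac{d}{d\lambda},$$ where $D^k$ is the $k$-fold iterate of $D$ (so $E_0=1$, $E_2(\lambda)=1+4\lambda+\lambda^2$). The polynomial $P_{2m-2}$. Put $$P_{2m-2}(\lambda)=\sum_{s=0}^{2m-2}p_s^{(2m-2)}\lambda^s=(1-e^{2h})(1-\lambda)^{2m-2}-2\bigl(\lambda(e^{2h}+1)-e^h(\lambda^2+1)\bigr)\sum_{j=1}^{m-1}\frac{h^{2j-1}(1-\lambda)^{2m-2-2j}E_{2j-2}(\lambda)}{(2j-1)!}.$$ (For $m=1$ the sum is empty, so $P_0=1-e^{2h}$.) Let $\lambda_1,\dots,\lambda_{m-1}$ be the roots of $P_{2m-2}$ with $|\lambda_k|<1$. The constants. Let $$C=1+(2m-2)e^h+e^{2h}+\frac{e^h\,p_{2m-3}^{(2m-2)}}{p_{2m-2}^{(2m-2)}},$$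 with $p_{-1}^{(0)}=0$ when $m=1$, and for $k=1,\dots,m-1$ let $$A_k=\frac{2(1-\lambda_k)^{2m-2}\left[\lambda_k(e^{2h}+1)-e^h(\lambda_k^2+1)\right]p_{2m-2}^{(2m-2)}}{\lambda_k P_{2m-2}'(\lambda_k)}.$$ The discrete operator. For $\beta\in\mathbb{Z}$, $$D_m(h\beta)=\frac{1}{p_{2m-2}^{(2m-2)}}\begin{cases}\displaystyle\sum_{k=1}^{m-1}A_k\lambda_k^{|\beta|-1}, & |\beta|\ge 2,\\[2mm] \displaystyle -2e^h+\sum_{k=1}^{m-1}A_k, & |\beta|=1,\\[2mm] \displaystyle 2C+\sum_{k=1}^{m-1}\frac{A_k}{\lambda_k}, & \beta=0.\end{cases}$$
   Formalization: Equalities 1, 2, 4 are asserted at each β where the convolution converges absolutely (proved to hold if |λ_k|e^h<1 for all k); for some h, e.g. m=2, h=2, these series diverge, so the claim for all h>0 is ill-defined. Item 3 is proved with convergence for all h>0. *)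

(* Defs.v *)
From HB Require Import structures.
From mathcomp Require Import all_boot all_order all_algebra.
From mathcomp Require Import all_classical all_reals all_analysis.
From mathcomp Require Import complex ring.

Set Implicit Arguments.
Unset Strict Implicit.
Unset Printing Implicit Defensive.

Import Order.TTheory GRing.Theory Num.Theory.
Import numFieldNormedType.Exports.

Local Open Scope classical_set_scope.
Local Open Scope ring_scope.
Local Open Scope complex_scope.

(* The polynomial E_k such that
     E_k(x) = (1 - x)^(k+2) / x * D^k (x / (1 - x)^2),  D = x d/dx,
   at every real x at which the right-hand side makes sense.  Such a polynomial
   exists, by [eulerpE] below, and it is unique, since two of them agree at
   infinitely many points. *)
Definition euler_rhs (R : realType) (k : nat) (x : R) : R :=
  (1 - x) ^+ (k + 2) / x *
  iter k (fun (f : R -> R) (y : R) => y * f^`()%classic y)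
         (fun y : R => y / (1 - y) ^+ 2) x.

Definition eulerp (R : realType) (k : nat) : {poly R} :=
  xget 0 [set p : {poly R} |
    forall x : R, x != 0 -> x != 1 -> p.[x] = euler_rhs k x].

Lemma euler_numS (R : realType) :
  { N : nat -> {poly R} | N 0%N = 1 /\ forall j,
   N j.+1 = (1 - 'X) * (N j + 'X * (N j)^`()) + (j + 2)%:R *: ('X * N j) }.
Proof.
by exists (fun k => iteri k (fun j (p : {poly R}) =>
    (1 - 'X) * (p + 'X * p^`()) + (j + 2)%:R *: ('X * p)) 1).
Qed.

Lemma iter_euler (R : realType) (N : nat -> {poly R}) : N 0%N = 1 ->
  (forall j,
   N j.+1 = (1 - 'X) * (N j + 'X * (N j)^`()) + (j + 2)%:R *: ('X * N j)) ->
  forall (k : nat) (x : R), x != 1 ->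
  iter k (fun (f : R -> R) (y : R) => y * f^`()%classic y)
         (fun y : R => y / (1 - y) ^+ 2) x
  = x * (N k).[x] / (1 - x) ^+ (k + 2).
Proof.
move=> N0 NS; elim=> [|k IHk] x x1 /=.
  by rewrite N0 hornerE mulr1.
have d0 : 1 - x != 0 by rewrite subr_eq0 eq_sym.
pose Q : {poly R} := 'X * N k; pose W : {poly R} := (1 - 'X) ^+ k.+2.
have Wx y : W.[y] = (1 - y) ^+ k.+2 by rewrite horner_exp !hornerE.
have Wx0 : W.[x] != 0 by rewrite Wx expf_neq0.
have H3 := @is_deriveV _ (horner W) x _ 1 Wx0 (is_derive_poly W x).
have H4 := @is_deriveM _ _ _ _ x 1 _ _ (is_derive_poly Q x) H3.
have nx : \forall z \near x,
  (horner Q * (fun y => (W.[y])^-1)) z =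
  iter k (fun (f : R -> R) (y : R) => y * f^`()%classic y)
         (fun y : R => y / (1 - y) ^+ 2) z.
  near=> z; rewrite IHk.
    by rewrite fctE Wx addn2 /Q !hornerE.
  by near: z; apply: open_nbhs_nbhs; split; [exact: open_neq|exact: x1].
have H5 := near_eq_is_derive nx H4.
rewrite derive1E (@derive_val _ _ _ _ _ _ _ H5).
have W'x : W^`().[x] = - ((k + 2)%:R * (1 - x) ^+ k.+1).
  rewrite /W deriv_exp derivB derivX derivC sub0r addn2.
  by rewrite hornerMn hornerM horner_exp !hornerE -mulr_natl; ring.
rewrite W'x !Wx NS /Q derivM derivX !(hornerE, hornerZ) /GRing.scale/=.
rewrite addSn !addn2 !exprS.
have : (1 - x) ^+ k != 0 by exact: expf_neq0.
move: ((1-x)^+k) ((N k).[x]) ((N k)^`().[x]) => t n n' t0.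
by field; rewrite t0 d0.
Unshelve. all: by end_near.
Qed.

Lemma eulerpE (R : realType) (k : nat) (x : R) : x != 0 -> x != 1 ->
  (eulerp R k).[x] = euler_rhs k x.
Proof.
have [N [N0 NS]] := euler_numS R.
have: [set p : {poly R} |
  forall x : R, x != 0 -> x != 1 -> p.[x] = euler_rhs k x] (eulerp R k).
  rewrite /eulerp; apply: (xgetPex 0); exists (N k) => y y0 y1.
  rewrite /euler_rhs (iter_euler N0 NS)//.
  have d0 : (1 - y) ^+ (k + 2) != 0 by rewrite expf_neq0// subr_eq0 eq_sym.
  by field; rewrite y0 d0.
by apply.
Qed.

Definition Ppoly (R : realType) (h : R) (m : nat) : {poly R} :=
  (1 - expR (2 * h))%:P * (1 - 'X) ^+ (2 * m - 2)
  - 2%:P * ((expR (2 * h) + 1) *: 'X - expR h *: ('X ^+ 2 + 1))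
    * \sum_(1 <= j < m)
        (h ^+ (2 * j - 1) / ((2 * j - 1)`!)%:R) *:
        ((1 - 'X) ^+ (2 * m - 2 - 2 * j) * eulerp R (2 * j - 2)).

Definition PpolyC (R : realType) (h : R) (m : nat) : {poly R[i]} :=
  map_poly (real_complex R) (Ppoly h m).

(* The roots of P_(2m-2) in the open unit disk, listed with multiplicity. *)
Definition inner_roots (R : realType) (h : R) (m : nat) : seq R[i] :=
  [seq z <- sval (closed_field_poly_normal (PpolyC h m)) | `|z| < 1].

Lemma mem_inner_roots (R : realType) (h : R) (m : nat) (z : R[i]) :
  PpolyC h m != 0 ->
  (z \in inner_roots h m) = root (PpolyC h m) z && (`|z| < 1).
Proof.
move=> P0; rewrite /inner_roots; case: closed_field_poly_normal => s /= Es.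
have lc0 : lead_coef (PpolyC h m) != 0 by rewrite lead_coef_eq0.
by rewrite mem_filter andbC {1}Es rootZ// root_prod_XsubC.
Qed.

Definition plead (R : realType) (h : R) (m : nat) : R :=
  (Ppoly h m)`_(2 * m - 2).

(* The case m = 1 is separate because 2 * m - 3 truncates to 0 there, while
   p_(-1) is 0. *)
Definition Cconst (R : realType) (h : R) (m : nat) : R :=
  1 + (2 * m - 2)%:R * expR h + expR (2 * h)
  + expR h * (if m == 1%N then 0 else (Ppoly h m)`_(2 * m - 3)) / plead h m.

Definition Acoef (R : realType) (h : R) (m : nat) (l : R[i]) : R[i] :=
  2 * (1 - l) ^+ (2 * m - 2)
  * (l * (expR (2 * h) + 1)%:C - (expR h)%:C * (l ^+ 2 + 1))
  * (plead h m)%:C / (l * (PpolyC h m)^`().[l]).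

Definition DmC (R : realType) (h : R) (m : nat) (b : int) : R[i] :=
  (plead h m)^-1%:C *
  (if (2 <= `|b|)%N then
     \sum_(l <- inner_roots h m) Acoef h m l * l ^+ (`|b| - 1)
   else if (`|b| == 1)%N then
     (- 2 * expR h)%:C + \sum_(l <- inner_roots h m) Acoef h m l
   else
     (2 * Cconst h m)%:C + \sum_(l <- inner_roots h m) Acoef h m l / l).

(* The roots may be nonreal, but they come in conjugate pairs, so [DmC] takes
   real values: see [Dm_real]. *)
Definition Dm (R : realType) (h : R) (m : nat) (b : int) : R :=
  complex.Re (DmC h m b).

Lemma conj_inner_roots (R : realType) (h : R) (m : nat) :
  PpolyC h m != 0 ->
  perm_eq (map conjc (inner_roots h m)) (inner_roots h m).
Proof.
move=> P0; rewrite /inner_roots; case: closed_field_poly_normal => s /= Es.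
have cP : map_poly conjc (PpolyC h m) = PpolyC h m.
  rewrite /PpolyC -map_poly_comp; apply: eq_map_poly => u /=.
  by rewrite oppr0.
have ps : perm_eq (map conjc s) s.
  apply: prod_XsubC_eq; have lc0 : lead_coef (PpolyC h m) != 0.
    by rewrite lead_coef_eq0.
  apply: (can_inj (scalerK lc0)); rewrite -Es -[in RHS]cP [in RHS]Es.
  rewrite map_polyZ/= rmorph_prod big_map -lead_coef_map cP.
  by congr (_ *: _); apply: eq_bigr => z _; rewrite rmorphB /= map_polyX map_polyC.
have e : [seq z <- s | `|z| < 1] = [seq z <- s | `|conjc z| < 1].
  by apply: eq_filter => z; rewrite normcJ.
by rewrite [X in map _ X]e -(filter_map conjc (fun z => `|z| < 1)); exact: perm_filter.
Qed.

Lemma Dm_real (R : realType) (h : R) (m : nat) (b : int) :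
  (Dm h m b)%:C = DmC h m b.
Proof.
have [P0|P0] := eqVneq (PpolyC h m) 0.
  have p0 : plead h m = 0.
    apply: (@complexI R); rewrite /plead -coef_map.
    by rewrite -/(PpolyC h m) P0 coef0.
  by rewrite /Dm /DmC p0 invr0 mul0r.
have [c cE] : {c : {rmorphism R[i] -> R[i]} | c =1 @conjc R} by exists (@conjc R).
have cR (u : R) : c u%:C = u%:C by rewrite cE /= oppr0.
suff: c (DmC h m b) = DmC h m b.
  rewrite cE /Dm; case: (DmC h m b) => u v /= [/eqP].
  by rewrite eq_sym -addr_eq0 -mulr2n mulrn_eq0 /= => /eqP ->.
have cP : map_poly c (PpolyC h m) = PpolyC h m.
  by rewrite /PpolyC -map_poly_comp; apply: eq_map_poly => u /=; rewrite cR.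
have c2 : c 2 = 2 by rewrite rmorph_nat.
have cdP l : c (PpolyC h m)^`().[l] = (PpolyC h m)^`().[c l].
  by rewrite -horner_map -deriv_map cP.
have cA l : c (Acoef h m l) = Acoef h m (c l).
  rewrite /Acoef fmorph_div !rmorphM rmorphXn !rmorphB !rmorphM.
  by rewrite !cR rmorph1 c2 cdP (rmorphD _ (l ^+ 2)) rmorphXn rmorph1.
have pc : perm_eq (map c (inner_roots h m)) (inner_roots h m).
  by rewrite (eq_map cE) conj_inner_roots.
have cS (F : R[i] -> R[i]) : (forall l, c (F l) = F (c l)) ->
    c (\sum_(l <- inner_roots h m) F l) = \sum_(l <- inner_roots h m) F l.
  move=> cF; rewrite rmorph_sum (eq_bigr (fun l => F (c l)))//.
  by rewrite -(big_map c xpredT F); exact: perm_big.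
rewrite /DmC rmorphM cR; congr (_ * _).
case: ifP => _; first by rewrite cS// => l; rewrite rmorphM rmorphXn cA.
case: ifP => _; rewrite rmorphD cR cS// => l.
by rewrite fmorph_div cA.
Qed.

Definition psim (R : realType) (m : nat) (x : R) : R :=
  Num.sg x / 2 *
  ((expR x - expR (- x)) / 2
   - \sum_(1 <= k < m) x ^+ (2 * k - 1) / ((2 * k - 1)`!)%:R).

(* Series indexed by the integers: [Negz n] is - (n + 1). *)
Definition abs_cvgZ (R : realType) (u : int -> R) : Prop :=
  cvgn [normed series (fun n : nat => u (Posz n))] /\
  cvgn [normed series (fun n : nat => u (Negz n))].

Definition sumZ (R : realType) (u : int -> R) : R :=
  limn (series (fun n : nat => u (Posz n))) +
  limn (series (fun n : nat => u (Negz n))).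

(* The convolution is a partial operation: it has a meaning at b only when its
   series converges absolutely there, and then its value is [zconv f g b].  [zconv]
   is a junk value when [zconv_cvg] fails.  For m = 2, 3 the absolute value of
   [Dm h m b] decays like |l|^|b|, where l is the inner root of largest modulus,
   so its convolution with e^(hb), e^(-hb) or psim(hb) converges absolutely
   exactly when |l| e^h < 1; this fails, for instance, for m = 2 and h = 2. *)
Definition zconv_cvg (R : realType) (f g : int -> R) (b : int) : Prop :=
  abs_cvgZ (fun c : int => f c * g (b - c)).

Definition zconv (R : realType) (f g : int -> R) (b : int) : R :=
  sumZ (fun c : int => f c * g (b - c)).

Definition atgrid (R : realType) (h : R) (f : R -> R) : int -> R :=
  fun b => f (h * b%:~R).

(* Main.v *)
Require Import Defs.
From HB Require Import structures.
From mathcomp Require Import all_boot all_order all_algebra.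
From mathcomp Require Import all_classical all_reals all_analysis.
From mathcomp Require Import complex ring lra zify.

Set Implicit Arguments.
Unset Strict Implicit.
Unset Printing Implicit Defensive.

Import Order.TTheory GRing.Theory Num.Theory.
Import numFieldNormedType.Exports.

Local Open Scope classical_set_scope.
Local Open Scope ring_scope.
Local Open Scope complex_scope.

(** Write [T] for the symmetric shift [(T f) b = f (b + 1) + f (b - 1)] on
    integer sequences, [S] and [C] for the hyperbolic sine and cosine of [h].
    The polynomial [P] of degree [2 m - 2] is palindromic, so that
    [P x = x ^ (m - 1) * Q (x + 1 / x)] with [Q] of degree [m - 1]; likewise
    [(1 - x) ^ (2 m - 2) * (x (e ^ (2 h) + 1) - e ^ h (x ^ 2 + 1))] is half of
    [x ^ m * N (x + 1 / x)] with
    [N t = - 2 e ^ h (t - 2) ^ (m - 1) (t - 2 C)].  The formula for the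
    operator [D] is nothing but the partial fraction decomposition of [N / Q],
    where [1 / (t - (l + 1 / l))] is represented, up to the factor [l - 1 / l],
    by the decaying sequence [l ^ |b|].  Hence [Q(T) D = N(T) delta]
    ([symbol_Dm]), and since [T] commutes with convolutions,
    [Q(T) (D * f) = N(T) f] whenever the convolution [D * f] converges
    ([zconv_symbol]).

    Everything follows from this relation.  The operator [N(T)] kills the
    characters [e ^ (h b)] and [e ^ (- h b)], because of its root [2 C], and the
    polynomials of degree at most [2 m - 3], because [T - 2] is the second
    difference.  It sends the fundamental solution to [Q(T) delta]
    ([symbol_psim]): each application of [T - 2] or [T - 2 C] to the absolute
    values of odd powers or of the hyperbolic sine leaves a term at the origin.
    So it remains to remove the factor [Q(T)].

    For [m <= 3] all roots [t] of [Q] are distinct and [t < -2]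
    ([Qpoly_split]); this is where the hyperbolic inequalities are used, which
    say where [Q] changes sign.  Consequently each [T - t] is injective on
    bounded sequences, and even on sequences of slow exponential growth, as
    [T] has norm close to [2] there ([act_prod_inj]).  Convolutions with
    polynomials grow slowly, so they vanish.  A convolution with a character is
    a multiple of this character, on which [Q(T)] acts by the nonzero number
    [Q (2 C)].  Finally, [D * psi] is bounded: [psi] is half of an odd function
    [g], with a change of sign at the origin, and [D * g] vanishes by the cases
    already treated, so that [D * psi] at [b] is a sum over the tail of [D]
    beyond [b] only ([conv_psim_bounded]). *)

(** * Absolutely convergent sums over the integers *)

Section SumZ.
Variable R : realType.
Implicit Types (a b : nat -> R) (u v w : int -> R) (k : R) (c : int).

Lemma acvg_le a b : (forall n, `|a n| <= `|b n|) ->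
  cvgn [normed series b] -> cvgn [normed series a].
Proof.
by move=> ab; apply: series_le_cvg => // n; exact: normr_ge0.
Qed.

Lemma acvgD a b : cvgn [normed series a] -> cvgn [normed series b] ->
  cvgn [normed series (a \+ b)].
Proof.
move=> ca cb; have := is_cvg_seriesD ca cb; apply: series_le_cvg => n /=.
- exact: normr_ge0.
- by rewrite addr_ge0.
- exact: ler_normD.
Qed.

Lemma acvgZ a k : cvgn [normed series a] ->
  cvgn [normed series (fun n => k * a n)].
Proof.
move=> ca; have := is_cvg_seriesZ (k := `|k|) ca.
by apply: series_le_cvg => n /=; rewrite ?mulr_ge0 ?normr_ge0// normrM.
Qed.

Lemma series_behead a (l : R) : series a @ \oo --> l <->
  series (fun n => a n.+1) @ \oo --> l - a 0%N.
Proof.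
have e : series (fun n => a n.+1) = (fun n => series a (n + 1)%N - a 0%N).
  apply/funext => n; rewrite addn1 !seriesEnat /=.
  by rewrite big_nat_recl// addrC addKr.
rewrite e -(cvg_shiftn 1 (series a)); split=> H.
  by apply: cvgB => //; exact: cvg_cst.
rewrite (_ : (fun n => _) =
  (fun n => series a (n + 1)%N - a 0%N) \+ cst (a 0%N)).
  by rewrite -[l](subrK (a 0%N)); apply: cvgD => //; exact: cvg_cst.
by apply/funext => n /=; rewrite subrK.
Qed.

Lemma acvg_behead a : cvgn [normed series a] <->
  cvgn [normed series (fun n => a n.+1)].
Proof.
split=> [/cvg_ex[l /= H]|/cvg_ex[l /= H]]; apply/cvg_ex.
  by exists (l - `|a 0%N|); apply/(series_behead (fun n => `|a n|)).
by exists (l + `|a 0%N|); apply/(series_behead (fun n => `|a n|)); rewrite addrK.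
Qed.

Lemma lim_behead a : cvgn [normed series a] ->
  limn (series (fun n => a n.+1)) = limn (series a) - a 0%N.
Proof.
move=> /normed_cvg ca; apply: cvg_lim => //.
exact: (series_behead a _).1 ca.
Qed.

Lemma abs_cvgZ_le u v : (forall c, `|u c| <= `|v c|) ->
  abs_cvgZ v -> abs_cvgZ u.
Proof.
move=> uv [v1 v2]; split; [move: v1|move: v2]; apply: acvg_le => n; exact: uv.
Qed.

Lemma eq_abs_cvgZ u v : u =1 v -> abs_cvgZ u -> abs_cvgZ v.
Proof. by move=> /funext ->. Qed.

Lemma abs_cvgZ_norm u : abs_cvgZ u <-> abs_cvgZ (fun c => `|u c|).
Proof. by split; apply: abs_cvgZ_le => c; rewrite normr_id. Qed.

Lemma abs_cvgZD u v : abs_cvgZ u -> abs_cvgZ v ->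
  abs_cvgZ (fun c => u c + v c).
Proof. by move=> [u1 u2] [v1 v2]; split; exact: acvgD. Qed.

Lemma abs_cvgZZ u k : abs_cvgZ u -> abs_cvgZ (fun c => k * u c).
Proof. by move=> [u1 u2]; split; exact: acvgZ. Qed.

Lemma sumZD u v : abs_cvgZ u -> abs_cvgZ v ->
  sumZ (fun c => u c + v c) = sumZ u + sumZ v.
Proof.
move=> [/normed_cvg u1 /normed_cvg u2] [/normed_cvg v1 /normed_cvg v2].
by rewrite {2 3}/sumZ addrACA -(lim_seriesD u1 v1) -(lim_seriesD u2 v2).
Qed.

Lemma sumZZ u k : abs_cvgZ u -> sumZ (fun c => k * u c) = k * sumZ u.
Proof.
by move=> [/normed_cvg u1 /normed_cvg u2]; rewrite {2}/sumZ mulrDr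
  -[k * limn _](lim_seriesZ k u1) -[k * limn _](lim_seriesZ k u2).
Qed.

Lemma abs_cvgZ0 : abs_cvgZ (fun=> 0 : R).
Proof.
have e : (fun n : nat => `|0 : R|) = 0 by apply/funext => n; rewrite normr0.
have H : cvgn (series (fun n : nat => `|0 : R|)).
  apply/cvg_ex; exists 0; rewrite (_ : series _ = cst 0); first exact: cvg_cst.
  by apply/funext => n; rewrite seriesEnat /= big1// => i _; rewrite normr0.
by split.
Qed.

Lemma sumZ0 : sumZ (fun=> 0 : R) = 0.
Proof.
by have := sumZZ 0 abs_cvgZ0; rewrite !mul0r.
Qed.

Lemma sumZ_norm_le u w : (forall c, `|u c| <= w c) -> abs_cvgZ w ->
  `|sumZ u| <= sumZ w.
Proof.
move=> uw cw.
have aw c : `|w c| = w c by rewrite ger0_norm// (le_trans _ (uw c)).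
have cu : abs_cvgZ u by apply: abs_cvgZ_le cw => c; rewrite aw.
case: (cu) (cw) => [u1 u2] [/normed_cvg w1 /normed_cvg w2].
apply: (le_trans (ler_normD _ _)); apply: lerD.
  by apply: (le_trans (lim_series_norm u1)); apply: lim_series_le => // n /=.
by apply: (le_trans (lim_series_norm u2)); apply: lim_series_le => // n /=.
Qed.

(** The two halves of an integer series exchange one term when the index is
    translated by one. *)
Lemma abs_cvgZ_succ u : abs_cvgZ u <-> abs_cvgZ (fun c => u (c + 1)).
Proof.
have eP n : u (Posz n + 1) = u (Posz n.+1) by rewrite -addn1.
have eN n : u (Negz n.+1 + 1) = u (Negz n).
  by congr u; rewrite !NegzE; lia.
rewrite /abs_cvgZ (acvg_behead (fun n => u (Posz n))).
rewrite (acvg_behead (fun n => u (Negz n + 1))).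
have eqS a a' : a =1 a' ->
    cvgn [normed series a] <-> cvgn [normed series a'].
  by move=> /funext ->.
by rewrite (eqS _ _ eP) (eqS _ _ eN).
Qed.

Lemma sumZ_succ u : abs_cvgZ u -> sumZ (fun c => u (c + 1)) = sumZ u.
Proof.
move=> cu; have /(abs_cvgZ_succ u) cu1 := cu.
have eP : (fun n : nat => u (Posz n + 1)) = (fun n => u (Posz n.+1)).
  by apply/funext => n; rewrite -addn1.
have eN : (fun n : nat => u (Negz n.+1 + 1)) = (fun n => u (Negz n)).
  by apply/funext => n; congr u; rewrite !NegzE; lia.
have := @lim_behead (fun n => u (Negz n + 1)) cu1.2.
have := @lim_behead (fun n => u (Posz n)) cu.1.
rewrite /sumZ eP eN => -> ->.
have -> : Negz 0 + 1 = 0 by [].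
ring.
Qed.

Lemma abs_cvgZ_pred u : abs_cvgZ u -> abs_cvgZ (fun c => u (c - 1)).
Proof.
move=> cu; apply/(abs_cvgZ_succ (fun c => u (c - 1))).
by rewrite (_ : (fun c => _) = u)//; apply/funext => c; rewrite addrK.
Qed.

Lemma sumZ_pred u : abs_cvgZ u -> sumZ (fun c => u (c - 1)) = sumZ u.
Proof.
move=> /abs_cvgZ_pred cu; rewrite -(sumZ_succ cu).
by congr sumZ; apply/funext => c; rewrite addrK.
Qed.

Lemma series_single a : (forall n, a n.+1 = 0) ->
  series a @ \oo --> a 0%N.
Proof.
move=> a0; apply/series_behead; rewrite subrr.
rewrite (_ : series _ = cst 0); first exact: cvg_cst.
by apply/funext => n; rewrite seriesEnat /= big1// => i _; rewrite a0.
Qed.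

Lemma abs_cvgZ_single u : (forall c, c != 0 -> u c = 0) -> abs_cvgZ u.
Proof.
move=> u0; split; apply/cvg_ex; [exists (`|u 0|)|exists (`|u (Negz 0)|)].
  by apply: (@series_single (fun n => `|u (Posz n)|)) => n; rewrite u0 ?normr0.
by apply: (@series_single (fun n => `|u (Negz n)|)) => n; rewrite u0 ?normr0.
Qed.

Lemma sumZ_single u : (forall c, c != 0 -> u c = 0) -> sumZ u = u 0.
Proof.
move=> u0; rewrite /sumZ.
rewrite (cvg_lim _ (@series_single (fun n => u (Posz n)) _))//; last first.
  by move=> n; rewrite u0.
rewrite (cvg_lim _ (@series_single (fun n => u (Negz n)) _))//; last first.
  by move=> n; rewrite u0.
by rewrite [u (Negz 0)]u0// addr0.
Qed.

Lemma abs_cvgZ_geometric (y : R) : `|y| < 1 ->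
  abs_cvgZ (fun c => y ^+ `|c|%N).
Proof.
move=> y1; have H : cvgn (series (fun n => `|y ^+ n|)).
  have := @is_cvg_geometric_series R 1 `|y|; rewrite normr_id => /(_ y1).
  by congr (cvgn (series _)); apply/funext => n; rewrite /= mul1r normrX.
by split => //; apply/(acvg_behead (fun n => y ^+ n)).
Qed.

End SumZ.

(** * Polynomials in the symmetric shift *)

Section Shift.
Variable R : realType.
Implicit Types (f g w : int -> R) (p q : {poly R}) (b c : int).

Definition sshift f : int -> R := fun b => f (b + 1) + f (b - 1).

Definition delta0 : int -> R := fun b => (b == 0)%:R.

Lemma sshift_linear : linear sshift.
Proof.
by move=> k f g; apply/funext => b; rewrite /sshift !fctE /= scalerDr addrACA.
Qed.

HB.instance Definition _ :=
  GRing.isLinear.Build R (int -> R) (int -> R) _ sshift sshift_linear.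

Lemma sshiftD f g : sshift (f + g) = sshift f + sshift g.
Proof. exact: linearD. Qed.

Lemma sshiftZ k f : sshift (k *: f) = k *: sshift f.
Proof. exact: linearZ_LR. Qed.

Definition act p f : int -> R := \sum_(i < size p) p`_i *: iter i sshift f.

Lemma act_wide n p f : (size p <= n)%N ->
  act p f = \sum_(i < n) p`_i *: iter i sshift f.
Proof.
move=> pn; rewrite /act (big_ord_widen n (fun i => p`_i *: iter i sshift f) pn).
rewrite big_mkcond; apply: eq_bigr => i _; case: ltnP => // pi.
by rewrite nth_default// scale0r.
Qed.

(** [act] with its arguments exchanged, to carry the linearity in the
    polynomial. *)
Definition act_on f p := act p f.

Lemma act_on_linear f : linear (act_on f).
Proof.
move=> k p q; rewrite /act_on; set n := maxn (size p) (size q).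
have sp : (size p <= n)%N by exact: leq_maxl.
have sq : (size q <= n)%N by exact: leq_maxr.
have spq : (size (k *: p + q)%R <= n)%N.
  apply: (leq_trans (size_polyD _ _)); rewrite geq_max sq andbT.
  exact: leq_trans (size_scale_leq _ _) sp.
rewrite (act_wide _ spq) (act_wide _ sp) (act_wide _ sq) scaler_sumr -big_split.
by apply: eq_bigr => i _; rewrite coefD coefZ scalerDl scalerA.
Qed.

HB.instance Definition _ f :=
  GRing.isLinear.Build R {poly R} (int -> R) _ (act_on f) (act_on_linear f).

Lemma actD p q f : act (p + q) f = act p f + act q f.
Proof. exact: (linearD (act_on f)). Qed.

Lemma actB p q f : act (p - q) f = act p f - act q f.
Proof. exact: (linearB (act_on f)). Qed.

Lemma actZ k p f : act (k *: p) f = k *: act p f.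
Proof. exact: (linearZ_LR (act_on f)). Qed.

Lemma act_suml (I : Type) (r : seq I) (F : I -> {poly R}) f :
  act (\sum_(i <- r) F i) f = \sum_(i <- r) act (F i) f.
Proof. exact: (linear_sum (act_on f)). Qed.

Lemma actC k f : act k%:P f = k *: f.
Proof.
rewrite (@act_wide 1) ?size_polyC ?leq_b1//.
by rewrite big_ord1 coefC eqxx.
Qed.

Lemma act1 f : act 1 f = f.
Proof. by rewrite -[1]/(1%:P) actC scale1r. Qed.

Lemma actMX p f : act (p * 'X) f = act p (sshift f).
Proof.
rewrite (@act_wide (size p).+1); last first.
  by rewrite (leq_trans (size_polyMleq _ _))// size_polyX addn2.
rewrite big_ord_recl coefMX eqxx scale0r add0r; apply: eq_bigr => i _.
by rewrite coefMX /= -iterS iterSr.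
Qed.

Lemma actX f : act 'X f = sshift f.
Proof. by rewrite -['X]mul1r actMX act1. Qed.

Lemma act_linear p : linear (act p).
Proof.
elim/poly_ind: p => [|p c IHp] k f g.
  by rewrite /act size_poly0 !big_ord0 scaler0 addr0.
rewrite !actD !actMX !actC linearP IHp !scalerDr !scalerA addrACA.
by rewrite (mulrC c).
Qed.

HB.instance Definition _ p :=
  GRing.isLinear.Build R (int -> R) (int -> R) _ (act p) (act_linear p).

Lemma actDr p f g : act p (f + g) = act p f + act p g.
Proof. exact: linearD. Qed.

Lemma actBr p f g : act p (f - g) = act p f - act p g.
Proof. exact: linearB. Qed.

Lemma actZr p k f : act p (k *: f) = k *: act p f.
Proof. exact: linearZ_LR. Qed.

Lemma act_sumr (I : Type) (r : seq I) (F : I -> int -> R) p :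
  act p (\sum_(i <- r) F i) = \sum_(i <- r) act p (F i).
Proof. exact: linear_sum. Qed.

Lemma act0r p : act p 0 = 0.
Proof. exact: linear0. Qed.

Lemma act_sshift p f : act p (sshift f) = sshift (act p f).
Proof.
elim/poly_ind: p f => [|p c IHp] f.
  by rewrite /act size_poly0 !big_ord0 linear0.
by rewrite !actD !actMX !actC sshiftD sshiftZ IHp.
Qed.

Lemma actM p q f : act (p * q) f = act p (act q f).
Proof.
elim/poly_ind: p f => [|p c IHp] f.
  by rewrite mul0r /act size_poly0 !big_ord0.
by rewrite mulrDl !actD mulrAC !actMX IHp mul_polyC actZ actC act_sshift.
Qed.

Lemma act_eigen p k f : sshift f = k *: f -> act p f = p.[k] *: f.
Proof.
move=> fk; elim/poly_ind: p => [|p c IHp].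
  by rewrite /act size_poly0 big_ord0 horner0 scale0r.
rewrite actD actMX actC fk actZr IHp hornerMXaddC scalerDl scalerA.
by rewrite (mulrC k).
Qed.

(** * Injectivity on slowly growing sequences *)

(** On sequences bounded by a multiple of [x ^ |b|] with the weighted sup norm
    the symmetric shift has norm at most [2 * x], so it has no eigenvalue of
    larger modulus there. *)
Lemma sshift_no_eigen (t x M : R) w : 1 <= x -> 2 * x < `|t| ->
  (forall b, `|w b| <= M * x ^+ `|b|%N) -> sshift w = t *: w -> w = 0.
Proof.
move=> x1 xt wM wt; have x0 : 0 < x by exact: lt_le_trans x1.
have X0 b : 0 < x ^+ `|b|%N by exact: exprn_gt0.
have t0 : 0 < `|t| by apply: lt_trans xt; rewrite mulr_gt0.
pose A := range (fun b => `|w b| / x ^+ `|b|%N).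
have A0 : A !=set0 by exists (`|w 0| / x ^+ `|0%Z|%N); exists 0.
have AM : has_ubound A.
  by exists M => _ [b _ <-]; rewrite ler_pdivrMr.
have wA b : `|w b| <= sup A * x ^+ `|b|%N.
  by rewrite -ler_pdivrMr//; apply: ub_le_sup => //; exists b.
have s0 : 0 <= sup A.
  by have := wA 0; rewrite expr0 mulr1; apply: le_trans.
have wA' b : `|w b| / x ^+ `|b|%N <= 2 * x / `|t| * sup A.
  rewrite ler_pdivrMr//.
  suff : `|t| * `|w b| <= 2 * x * sup A * x ^+ `|b|%N.
    by rewrite -ler_pdivlMl// => /le_trans; apply; lra.
  have step d : (`|d| <= `|b| + 1)%N ->
      `|w d| <= sup A * (x * x ^+ `|b|%N).
    move=> bd; apply: (le_trans (wA d)); apply: ler_wpM2l => //.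
    by rewrite -exprS -addn1 ler_weXn2l.
  rewrite -normrM (_ : t * w b = sshift w b); last by rewrite wt.
  apply: (le_trans (ler_normD _ _)).
  have := step (b + 1); have := step (b - 1).
  by move=> /(_ ltac:(lia)) ? /(_ ltac:(lia)) ?; lra.
have : sup A <= 2 * x / `|t| * sup A by apply: ge_sup => // _ [b _ <-].
rewrite mulrAC -subr_le0 => s1.
have : sup A * (1 - 2 * x / `|t|) <= 0 by rewrite mulrBr mulr1; lra.
rewrite pmulr_lle0; last by rewrite subr_gt0 ltr_pdivrMr// mul1r.
move=> s2; apply/funext => b; apply/eqP; rewrite -normr_le0.
apply: (le_trans (wA b)); rewrite pmulr_lle0//.
Qed.

(** The same holds for a product of factors [T - t]: they are peeled off one at
    a time, as [sshift] preserves the growth condition. *)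
Lemma act_prod_inj (ts : seq R) (x M : R) w : 1 <= x ->
  (forall t, t \in ts -> 2 * x < `|t|) ->
  (forall b, `|w b| <= M * x ^+ `|b|%N) ->
  act (\prod_(t <- ts) ('X - t%:P)) w = 0 -> w = 0.
Proof.
move=> x1; elim: ts M w => [|t ts IH] M w xt wM.
  by rewrite big_nil act1.
rewrite big_cons mulrC actM actB actX actC => /IH.
have xts u : u \in ts -> 2 * x < `|u|.
  by move=> uts; apply: xt; rewrite inE uts orbT.
have /xt xt' : t \in t :: ts by rewrite inE eqxx.
move=> /(_ ((2 * x + `|t|) * M) xts) H.
apply: (sshift_no_eigen x1 xt' wM); apply/eqP; rewrite -subr_eq0; apply/eqP.
apply: H => b; apply: (le_trans (ler_normB _ _)).
have M0 : 0 <= M by have := wM 0; rewrite expr0 mulr1; apply: le_trans.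
have step d : (`|d| <= `|b| + 1)%N -> `|w d| <= M * (x * x ^+ `|b|%N).
  move=> bd; apply: (le_trans (wM d)); apply: ler_wpM2l => //.
  by rewrite -exprS -addn1 ler_weXn2l.
have tw : `|(t *: w) b| <= `|t| * (M * x ^+ `|b|%N).
  by rewrite normrM ler_wpM2l.
have sw : `|sshift w b| <= 2 * (M * (x * x ^+ `|b|%N)).
  apply: (le_trans (ler_normD _ _)).
  have := step (b + 1); have := step (b - 1).
  by move=> /(_ ltac:(lia)) ? /(_ ltac:(lia)) ?; lra.
by apply: (le_trans (lerD sw tw)); lra.
Qed.

(** * Convolutions and the symmetric shift *)

Lemma zconvDl f g w b : zconv_cvg f w b -> zconv_cvg g w b ->
  zconv_cvg (f + g) w b /\ zconv (f + g) w b = zconv f w b + zconv g w b.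
Proof.
move=> cf cg; rewrite /zconv_cvg /zconv -sumZD//.
rewrite (_ : (fun c => (f + g) c * w (b - c)) =
  fun c => f c * w (b - c) + g c * w (b - c)).
  by split => //; exact: abs_cvgZD.
by apply/funext => c; rewrite fctE mulrDl.
Qed.

Lemma zconvZl k f w b : zconv_cvg f w b ->
  zconv_cvg (k *: f) w b /\ zconv (k *: f) w b = k * zconv f w b.
Proof.
move=> cf; rewrite /zconv_cvg /zconv -sumZZ//.
rewrite (_ : (fun c => (k *: f) c * w (b - c)) =
  fun c => k * (f c * w (b - c))).
  by split => //; exact: abs_cvgZZ.
by apply/funext => c; rewrite fctE -mulrA.
Qed.

Lemma zconvDr f g w b : zconv_cvg w f b -> zconv_cvg w g b ->
  zconv_cvg w (f + g) b /\ zconv w (f + g) b = zconv w f b + zconv w g b.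
Proof.
move=> cf cg; rewrite /zconv_cvg /zconv -sumZD//.
rewrite (_ : (fun c => w c * (f + g) (b - c)) =
  fun c => w c * f (b - c) + w c * g (b - c)).
  by split => //; exact: abs_cvgZD.
by apply/funext => c; rewrite fctE mulrDr.
Qed.

Lemma zconvZr k f w b : zconv_cvg w f b ->
  zconv_cvg w (k *: f) b /\ zconv w (k *: f) b = k * zconv w f b.
Proof.
move=> cf; rewrite /zconv_cvg /zconv -sumZZ//.
rewrite (_ : (fun c => w c * (k *: f) (b - c)) =
  fun c => k * (w c * f (b - c))).
  by split => //; exact: abs_cvgZZ.
by apply/funext => c; rewrite fctE mulrCA.
Qed.

(** Both equal the convolution of [f] with the shifted [w], after translating the
    summation index. *)
Lemma zconv_sshift f w : (forall b, zconv_cvg f w b) ->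
  (forall b, zconv_cvg (sshift f) w b) /\
  zconv (sshift f) w = sshift (zconv f w).
Proof.
move=> cf.
have e1 b : (fun c => f (c + 1) * w (b - c)) =
    fun c => f (c + 1) * w (b + 1 - (c + 1)).
  by apply/funext => c; congr (_ * w _); ring.
have e2 b : (fun c => f (c - 1) * w (b - c)) =
    fun c => f (c - 1) * w (b - 1 - (c - 1)).
  by apply/funext => c; congr (_ * w _); ring.
have c1 b : abs_cvgZ (fun c => f (c + 1) * w (b - c)).
  rewrite e1; apply/(abs_cvgZ_succ (fun c => f c * w (b + 1 - c))).
  exact: cf.
have c2 b : abs_cvgZ (fun c => f (c - 1) * w (b - c)).
  rewrite e2; apply: (@abs_cvgZ_pred _ (fun c => f c * w (b - 1 - c))).
  exact: cf.
have e b : (fun c => sshift f c * w (b - c)) =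
    fun c => f (c + 1) * w (b - c) + f (c - 1) * w (b - c).
  by apply/funext => c; rewrite /sshift mulrDl.
split=> [b|]; first by rewrite /zconv_cvg e; exact: abs_cvgZD.
apply/funext => b; rewrite {1}/zconv e sumZD// e1 e2.
rewrite (@sumZ_succ _ (fun c => f c * w (b + 1 - c)) (cf (b + 1))).
by rewrite (@sumZ_pred _ (fun c => f c * w (b - 1 - c)) (cf (b - 1))).
Qed.

Lemma zconv_act p f w : (forall b, zconv_cvg f w b) ->
  (forall b, zconv_cvg (act p f) w b) /\
  zconv (act p f) w = act p (zconv f w).
Proof.
elim/poly_ind: p f => [|p k IHp] f cf.
  rewrite /act size_poly0 !big_ord0.
  have e b : (fun c => (0 : int -> R) c * w (b - c)) = fun=> 0.
    by apply/funext => c; rewrite mul0r.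
  split=> [b|]; rewrite /zconv_cvg ?e; first exact: abs_cvgZ0.
  by apply/funext => b; rewrite /zconv e sumZ0.
have [cT eT] := zconv_sshift cf; have [cp ep] := IHp _ cT.
rewrite !actD !actMX !actC -eT -ep; split=> [b|].
  by apply: (zconvDl (cp b) _).1; exact: (zconvZl k (cf b)).1.
apply/funext => b.
rewrite (zconvDl (cp b) (zconvZl k (cf b)).1).2.
by rewrite (zconvZl k (cf b)).2.
Qed.

Lemma zconv_delta0 w :
  (forall b, zconv_cvg delta0 w b) /\ zconv delta0 w = w.
Proof.
have d0 b c : c != 0 -> delta0 c * w (b - c) = 0.
  by rewrite /delta0 => /negbTE ->; rewrite mul0r.
split=> [b|]; first by apply: abs_cvgZ_single => c; exact: d0.
apply/funext => b; rewrite /zconv sumZ_single; last by move=> c; exact: d0.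
by rewrite /delta0 eqxx mul1r subr0.
Qed.

(** If [q / p] is the symbol of [f], then convolution with [f] inverts [p(T)] up
    to [q(T)]. *)
Lemma zconv_symbol p q f w : act p f = act q delta0 ->
  (forall b, zconv_cvg f w b) -> act p (zconv f w) = act q w.
Proof.
move=> pf cf; rewrite -(zconv_act p cf).2 pf.
by rewrite (zconv_act q (zconv_delta0 w).1).2 (zconv_delta0 w).2.
Qed.

(** Since [|b - c| <= |b| + |c|], convolution with a sequence that is summable
    with weight [x ^ |c|] preserves growth of rate [x]. *)
Lemma zconv_growth (D f : int -> R) (x M : R) : 1 <= x ->
  abs_cvgZ (fun c => D c * x ^+ `|c|%N) ->
  (forall b, `|f b| <= M * x ^+ `|b|%N) ->
  (forall b, zconv_cvg D f b) /\
  exists M', forall b, `|zconv D f b| <= M' * x ^+ `|b|%N.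
Proof.
move=> x1 cD fM; have x0 : 0 < x by lra.
have M0 : 0 <= M by have := fM 0; rewrite expr0 mulr1; apply: le_trans.
have cD' : abs_cvgZ (fun c => `|D c * x ^+ `|c|%N|).
  exact: (abs_cvgZ_norm _).1 cD.
have le b c : `|D c * f (b - c)| <= M * x ^+ `|b|%N * `|D c * x ^+ `|c|%N|.
  rewrite !normrM (ger0_norm (exprn_ge0 _ (ltW x0))).
  rewrite [leRHS]mulrCA ler_wpM2l//; apply: (le_trans (fM _)).
  by rewrite -mulrA -exprD ler_wpM2l// ler_weXn2l//; lia.
have cM b := abs_cvgZZ (M * x ^+ `|b|%N) cD'.
split=> [b|].
  apply: abs_cvgZ_le (cM b) => c; apply: (le_trans (le b c)); exact: ler_norm.
exists (M * sumZ (fun c => `|D c * x ^+ `|c|%N|)) => b.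
apply: (le_trans (sumZ_norm_le (le b) (cM b))).
by rewrite sumZZ// mulrAC.
Qed.

End Shift.

(** * Positivity of mixed polynomial and hyperbolic expressions *)

Section Hyperbolic.
Variable R : realType.
Implicit Types (x : R) (a b r : {poly R}).

Definition sinhR x := (expR x - expR (- x)) / 2.
Definition coshR x := (expR x + expR (- x)) / 2.

Lemma is_derive_expRN x :
  is_derive x 1 (fun y : R => expR (- y)) (- expR (- x)).
Proof.
have H := is_derive1_comp (is_derive_expR (- x)) (is_deriveNid x 1).
by apply: is_derive_eq H _; rewrite mulrN1.
Qed.

Lemma is_derive_sinhR x : is_derive x 1 sinhR (coshR x).
Proof.
have H := is_deriveZ 2^-1 (is_deriveB (is_derive_expR x) (is_derive_expRN x)).
rewrite (_ : sinhR = 2^-1 \*: (@expR R - fun y => expR (- y))).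
  by apply: is_derive_eq; rewrite /coshR opprK mulrC.
by apply/funext => y; rewrite /sinhR mulrC.
Qed.

Lemma is_derive_coshR x : is_derive x 1 coshR (sinhR x).
Proof.
have H := is_deriveZ 2^-1 (is_deriveD (is_derive_expR x) (is_derive_expRN x)).
rewrite (_ : coshR = 2^-1 \*: (@expR R + fun y => expR (- y))).
  by apply: is_derive_eq; rewrite /sinhR mulrC.
by apply/funext => y; rewrite /coshR mulrC.
Qed.

Lemma sinhR0 : sinhR 0 = 0. Proof. by rewrite /sinhR oppr0 subrr mul0r. Qed.

Lemma coshR0 : coshR 0 = 1.
Proof. by rewrite /coshR oppr0 expR0; field. Qed.

Lemma sinhR_gt0 x : 0 < x -> 0 < sinhR x.
Proof.
by move=> x0; rewrite /sinhR divr_gt0// subr_gt0 ltr_expR; lra.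
Qed.

Lemma coshR_gt0 x : 0 < coshR x.
Proof. by rewrite /coshR divr_gt0// addr_gt0// expR_gt0. Qed.

Definition hyp_expr a b r x := a.[x] * sinhR x + b.[x] * coshR x + r.[x].

(** Positivity propagates from a derivative and the value at 0.  The derivative
    is again of the same form, and a few steps make all coefficients
    nonnegative. *)
Lemma hyp_expr_gt0 a b r a' b' r' :
  a^`() + b = a' -> a + b^`() = b' -> r^`() = r' -> 0 <= hyp_expr a b r 0 ->
  (forall x, 0 < x -> 0 < hyp_expr a' b' r' x) ->
  forall x, 0 < x -> 0 < hyp_expr a b r x.
Proof.
move=> <- <- <- f0 f'_gt0 x x0.
have df (y : R) : is_derive y 1 (hyp_expr a b r)
    (hyp_expr (a^`() + b) (a + b^`()) r^`() y).
  have H := is_deriveD (is_deriveD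
    (is_deriveM (is_derive_poly a y) (is_derive_sinhR y))
    (is_deriveM (is_derive_poly b y) (is_derive_coshR y)))
    (is_derive_poly r y).
  apply: is_derive_eq H _.
  by rewrite /hyp_expr !hornerD /GRing.scale/=; ring.
have cf : {within `[0, x], continuous (hyp_expr a b r)}.
  by apply: derivable_within_continuous => y _; exact: ex_derive.
have [c /[!in_itv]/= /andP[c0 _]] := MVT x0 (fun y _ => df y) cf.
rewrite subr0 => e; rewrite -[X in 0 < X](subrK (hyp_expr a b r 0)) e.
by rewrite ltr_wpDr// mulr_gt0// f'_gt0.
Qed.

End Hyperbolic.

Section Inequalities.
Variable R : realType.
Implicit Types x : R.

Local Ltac hyp_eval := rewrite /hyp_expr;
  move: (sinhR _) (coshR _) => ? ?; rewrite !(hornerE, hornerMn) /=.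

Local Ltac differentiate p q s := apply: (@hyp_expr_gt0 _ _ _ _ p q s);
  [by rewrite !poly.derivE; ring | by rewrite !poly.derivE; ring |
   by rewrite !poly.derivE; ring |
   by rewrite /hyp_expr sinhR0 coshR0 !(hornerE, hornerMn) /=; lra |].

Local Notation X := ('X : {poly R}).

Lemma id_lt_sinhR x : 0 < x -> x < sinhR x.
Proof.
move=> x_gt0; suff : 0 < hyp_expr 1 0 (- X) x by hyp_eval; lra.
move: x x_gt0; differentiate (0 : {poly R}) (1 : {poly R}) ((- 1) : {poly R}).
differentiate (1 : {poly R}) (0 : {poly R}) (0 : {poly R}).
by move=> y /sinhR_gt0; hyp_eval; lra.
Qed.

Lemma cubic_lt_sinhR x : 0 < x -> x + x ^+ 3 / 6 < sinhR x.
Proof.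
move=> x_gt0; suff : 0 < hyp_expr 6%:P 0 (- 6%:P * X - X ^+ 3) x by hyp_eval; lra.
move: x x_gt0; differentiate (0 : {poly R}) (6%:P : {poly R}) (- 6%:P - 3%:P * X ^+ 2).
differentiate (6%:P : {poly R}) (0 : {poly R}) (- 6%:P * X).
by move=> y /id_lt_sinhR; hyp_eval; lra.
Qed.

(** This inequality and the next two give the signs of [Qpoly h 2] at -2 and of
    [Qpoly h 3] at -2 and at -6. *)
Lemma sinhR_lt_coshR1 x : 0 < x -> 2 * sinhR x < x * (coshR x + 1).
Proof.
move=> x_gt0; suff : 0 < hyp_expr (- 2%:P) X X x by hyp_eval; lra.
move: x x_gt0; differentiate ('X : {poly R}) ((- 1) : {poly R}) (1 : {poly R}).
differentiate (0 : {poly R}) ('X : {poly R}) (0 : {poly R}).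
by move=> y y0; have := mulr_gt0 y0 (coshR_gt0 y); hyp_eval; lra.
Qed.

Lemma coshR1_lt_sinhR x : 0 < x -> (4 * x - x ^+ 3 / 3) * (coshR x + 1) < 8 * sinhR x.
Proof.
move=> x_gt0; suff : 0 < hyp_expr 24%:P (X ^+ 3 - 12%:P * X) (X ^+ 3 - 12%:P * X) x.
  by hyp_eval; lra.
move: x x_gt0.
differentiate (X ^+ 3 - 12%:P * X) (3%:P * X ^+ 2 + 12%:P)
  (3%:P * X ^+ 2 - 12%:P).
differentiate (6%:P * X ^+ 2) (X ^+ 3 - 6%:P * X) (6%:P * X).
differentiate (X ^+ 3 + 6%:P * X) (9%:P * X ^+ 2 - 6%:P) (6%:P : {poly R}).
differentiate (12%:P * X ^+ 2) (X ^+ 3 + 24%:P * X) (0 : {poly R}).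
move=> y y0; have C0 := coshR_gt0 y.
have := mulr_gt0 y0 C0; have := mulr_gt0 (exprn_gt0 3 y0) C0.
have := mulr_gt0 (exprn_gt0 2 y0) (sinhR_gt0 y0); hyp_eval; lra.
Qed.

Lemma sinhR_lt_coshR3 x : 0 < x ->
  64 * sinhR x < (16 * x + 2 / 3 * x ^+ 3) * (coshR x + 3).
Proof.
move=> x_gt0; suff : 0 < hyp_expr (- 192%:P) (48%:P * X + 2%:P * X ^+ 3)
    (144%:P * X + 6%:P * X ^+ 3) x by hyp_eval; lra.
move: x x_gt0.
differentiate (48%:P * X + 2%:P * X ^+ 3) (6%:P * X ^+ 2 - 144%:P)
  (144%:P + 18%:P * X ^+ 2).
differentiate (12%:P * X ^+ 2 - 96%:P) (2%:P * X ^+ 3 + 60%:P * X) (36%:P * X).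
differentiate (2%:P * X ^+ 3 + 84%:P * X) (18%:P * X ^+ 2 - 36%:P)
  (36%:P : {poly R}).
differentiate (24%:P * X ^+ 2 + 48%:P) (2%:P * X ^+ 3 + 120%:P * X)
  (0 : {poly R}).
move=> y y0; have C0 := coshR_gt0 y; have S0 := sinhR_gt0 y0.
have := mulr_gt0 y0 C0; have := mulr_gt0 (exprn_gt0 3 y0) C0.
have := mulr_gt0 (exprn_gt0 2 y0) S0; move: S0; hyp_eval; lra.
Qed.

End Inequalities.

(** * The symbol in the variable x + 1/x *)

Section Symbol.
Variable R : realType.
Implicit Types (h t x : R) (m : nat) (p q : {poly R}).

(** The half-line avoids 0 and 1, where the rational identities to be transferred
    to polynomials may fail. *)
Lemma poly_eq_gt1 p q : (forall x, 1 < x -> p.[x] = q.[x]) -> p = q.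
Proof.
move=> pq; apply/eqP; rewrite -subr_eq0; apply/eqP.
apply: (@roots_geq_poly_eq0 _ _ [seq i.+2%:R | i <- iota 0 (size (p - q))]).
- apply/allP => _ /mapP[i _ ->].
  by rewrite rootE hornerD hornerN pq ?subrr// ltr1n.
- rewrite map_inj_uniq ?iota_uniq// => i j /eqP.
  by rewrite eqr_nat => /eqP[].
- by rewrite size_map size_iota.
Qed.

Lemma eulerp_eq (N : nat -> {poly R}) : N 0%N = 1 ->
  (forall j,
   N j.+1 = (1 - 'X) * (N j + 'X * (N j)^`()) + (j + 2)%:R *: ('X * N j)) ->
  forall k, eulerp R k = N k.
Proof.
move=> N0 NS k; apply: poly_eq_gt1 => x x1.
have x0 : x != 0 by rewrite gt_eqF// (lt_trans _ x1).
have x1' : x != 1 by rewrite gt_eqF.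
have d0 : (1 - x) ^+ (k + 2) != 0 by rewrite expf_neq0// subr_eq0 eq_sym.
rewrite eulerpE// /euler_rhs (iter_euler N0 NS)//.
by field; rewrite x0 d0.
Qed.

Lemma eulerp0 : eulerp R 0 = 1.
Proof. by have [N [N0 NS]] := euler_numS R; rewrite (eulerp_eq N0 NS). Qed.

Lemma eulerp2 : eulerp R 2 = 1 + 4%:P * 'X + 'X ^+ 2.
Proof.
have [N [N0 NS]] := euler_numS R; rewrite (eulerp_eq N0 NS).
rewrite NS NS N0 -!mul_polyC !poly.derivE; ring.
Qed.

(** The sum over [j] in [Ppoly], divided by [x ^ (m - 2)] and written in the
    variable [t = x + 1 / x]: there [(1 - x) ^ 2 / x] is [t - 2], and the Euler
    polynomials of index 0 and 2 become 1 and [t + 4]. *)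
Definition Upoly h m : {poly R} :=
  match m with
  | 2 => h%:P
  | 3 => h *: ('X - 2%:P) + (h ^+ 3 / 6) *: ('X + 4%:P)
  | _ => 0
  end.

Definition Qpoly h m : {poly R} := (- 2 * expR h) *:
  (sinhR h *: ('X - 2%:P) ^+ m.-1 - ('X - (2 * coshR h)%:P) * Upoly h m).

Definition Npoly h m : {poly R} :=
  (- 2 * expR h) *: (('X - 2%:P) ^+ m.-1 * ('X - (2 * coshR h)%:P)).

Lemma expR_double h : expR (2 * h) = expR h ^+ 2.
Proof. by rewrite mulrC expRM_natr. Qed.

Lemma sinhR_expR h : 1 - expR (2 * h) = - 2 * expR h * sinhR h.
Proof.
rewrite expR_double /sinhR expRN; have := expR_gt0 h.
by move: (expR h) => e e0; field; lra.
Qed.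

Lemma coshR_expR h : expR (2 * h) + 1 = 2 * expR h * coshR h.
Proof.
rewrite expR_double /coshR expRN; have := expR_gt0 h.
by move: (expR h) => e e0; field; lra.
Qed.

Lemma Ppoly_sym h m x : (1 <= m <= 3)%N -> x != 0 ->
  (Ppoly h m).[x] = x ^+ m.-1 * (Qpoly h m).[x + x^-1].
Proof.
move=> m123 x0; rewrite /Ppoly /Qpoly sinhR_expR coshR_expR.
move: (expR h) (sinhR h) (coshR h) => e s c.
case: m m123 => [|[|[|[|]]]]//= _.
- by rewrite big_geq// !(hornerE, hornerMn) /=; ring.
- rewrite big_nat1 eulerp0 !(hornerE, hornerMn) -[(2 - 1)%N]/1%N /=.
  by rewrite -[1`!]/1%N; field.
- rewrite big_nat_recr//= big_nat1 eulerp0 eulerp2 !(hornerE, hornerMn) /=.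
  rewrite -[(2 * 2 - 1)%N]/3%N -[(2 - 1)%N]/1%N -[3`!]/6%N -[1`!]/1%N.
  by field.
Qed.

(** For [m = 3] the quadratic factor [q] has positive leading coefficient, is
    negative at -6 and positive at -2: so one root lies between these points and
    the other one to the left of -6. *)
Lemma Qpoly_split h m : 0 < h -> (1 <= m <= 3)%N ->
  exists k ts, [/\ k != 0, size ts = m.-1, uniq ts,
    (forall t, t \in ts -> t < -2) &
    Qpoly h m = k *: \prod_(t <- ts) ('X - t%:P)].
Proof.
move=> h0; have e0 : - 2 * expR h != 0.
  by rewrite lt_eqF//; have := expR_gt0 h; lra.
have S1 := id_lt_sinhR h0; have S3 := cubic_lt_sinhR h0.
have L1 := sinhR_lt_coshR1 h0.
have G3 := coshR1_lt_sinhR h0; have L3 := sinhR_lt_coshR3 h0.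
have s0 := sinhR_gt0 h0; rewrite /Qpoly.
move: (expR h) (sinhR h) (coshR h) e0 S1 S3 L1 G3 L3 s0
  => e s c e0 S1 S3 L1 G3 L3 s0.
case: m => [|[|[|[|]]]]//= _.
- exists (- 2 * e * s), [::]; split => //; first by rewrite mulf_neq0// gt_eqF.
  by rewrite big_nil expr0 mulr0 subr0 scalerA.
- have d0 : s - h != 0 by rewrite gt_eqF// subr_gt0.
  exists (- 2 * e * (s - h)), [:: (2 * s - 2 * h * c) / (s - h)].
  split => //; first by rewrite mulf_neq0.
    by move=> t; rewrite inE => /eqP ->; rewrite ltr_pdivrMr ?subr_gt0//; lra.
  apply: poly_eq_gt1 => x _; rewrite big_seq1 !hornerE /=.
  by field.
- pose k := s - h - h ^+ 3 / 6.
  have k0 : 0 < k by rewrite /k; lra.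
  pose q := s *: ('X - 2%:P) ^+ 2 - ('X - (2 * c)%:P) *
    (h *: ('X - 2%:P) + (h ^+ 3 / 6) *: ('X + 4%:P)).
  pose b := - 4 * s + 2 * h + 2 * c * h - 4 * (h ^+ 3 / 6)
    + 2 * c * (h ^+ 3 / 6).
  have qE x : q.[x] = k * x ^+ 2 + b * x
      + (4 * s - 4 * c * h + 8 * c * (h ^+ 3 / 6)).
    by rewrite /q /k /b !hornerE /=; ring.
  have q6 : q.[-6] < 0 by rewrite /q !hornerE /=; lra.
  have q2 : 0 < q.[-2] by rewrite /q !hornerE /=; lra.
  have [||t1 /andP[t1l t1r] /rootP t1q] := @poly_ivt R q (-6) (-2).
  - by lra.
  - by rewrite (ltW q6) (ltW q2).
  (* the other root, from the sum of the two *)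
  pose t2 := - b / k - t1.
  have qf x : q.[x] = k * (x - t1) * (x - t2).
    have -> : q.[x] = q.[x] - q.[t1] by rewrite t1q subr0.
    by rewrite !qE /t2; field; rewrite gt_eqF.
  have t1l' : -6 < t1.
    by rewrite lt_neqAle t1l andbT; apply/eqP => E; rewrite E t1q ltxx in q6.
  have t1r' : t1 < -2.
    by rewrite lt_neqAle t1r andbT; apply/eqP => E; rewrite -E t1q ltxx in q2.
  have t2l : t2 < -6.
    move: q6; rewrite qf -mulrA pmulr_rlt0//.
    by rewrite nmulr_rlt0; lra.
  exists (- 2 * e * k), [:: t1; t2]; split => //.
  + by rewrite mulf_neq0// gt_eqF.
  + by rewrite /= inE andbT gt_eqF//; lra.
  + by move=> t; rewrite !inE => /orP[] /eqP ->; lra.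
  + rewrite -(scalerA (- 2 * e) k); congr (_ *: _); apply: poly_eq_gt1 => x _.
    by rewrite -/q qf !big_cons big_nil !hornerE /=; ring.
Qed.

End Symbol.

(** * Lagrange interpolation and the small roots *)

Section Lagrange.
Variable F : fieldType.
Implicit Types (ts rs : seq F) (p : {poly F}).

(** At a simple root [t] this takes the value of the derivative of the full
    product. *)
Definition others ts t : {poly F} := \prod_(u <- ts | u != t) ('X - u%:P).

Lemma others_neq0 ts t : (others ts t).[t] != 0.
Proof.
rewrite horner_prod prodf_seq_neq0; apply/allP => u _; apply/implyP => ut.
by rewrite !hornerE subr_eq0 eq_sym.
Qed.

Lemma size_others ts t : uniq ts -> t \in ts -> size (others ts t) = size ts.
Proof.
move=> uts tts; have := size_prod_XsubC ts id.
rewrite (bigD1_seq t)//= -/(others ts t) size_monicM ?monicXsubC//; last first.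
  by apply/eqP => e; have := others_neq0 ts t; rewrite e horner0 eqxx.
by rewrite size_XsubC addSn add1n => -[].
Qed.

Lemma lagrange ts p : uniq ts -> (size p <= size ts)%N ->
  \sum_(t <- ts) (p.[t] / (others ts t).[t]) *: others ts t = p.
Proof.
move=> uts sp; apply/eqP; rewrite -subr_eq0; apply/eqP.
apply: (@roots_geq_poly_eq0 _ _ ts) => //.
  apply/allP => t tts; rewrite rootE hornerD hornerN horner_sum subr_eq0.
  rewrite (bigD1_seq t)//= hornerZ divfK ?others_neq0// big1_seq ?addr0// => u.
  move=> /andP[ut _]; rewrite hornerZ [X in _ * X](_ : _ = 0) ?mulr0//.
  apply/eqP; rewrite /others horner_prod prodf_seq_eq0; apply/hasP; exists t => //.
  by rewrite hornerXsubC subrr eqxx andbT eq_sym.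
apply: (leq_trans (size_polyD _ _)); rewrite size_polyN geq_max sp andbT.
rewrite big_seq; apply: (big_ind (fun q : {poly F} => (size q <= size ts)%N)).
- by rewrite size_poly0.
- by move=> q r sq sr; rewrite (leq_trans (size_polyD _ _))// geq_max sq.
- by move=> t tts; rewrite (leq_trans (size_scale_leq _ _))// size_others.
Qed.

(** The two leading coefficients of a monic polynomial are 1 and the opposite of
    the sum of its roots. *)
Lemma size_sub_prod_XsubC n rs ts : size rs = n.+1 -> size ts = n.+1 ->
  \sum_(r <- rs) r = \sum_(t <- ts) t ->
  (size (\prod_(r <- rs) ('X - r%:P) - \prod_(t <- ts) ('X - t%:P))%R <= n)%N.
Proof.
move=> sr st e; apply/leq_sizeP => j nj; rewrite coefB.
have lead ss : size ss = n.+1 -> (\prod_(r <- ss) ('X - r%:P))`_n.+1 = 1.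
  move=> s1; have := monic_prod_XsubC ss predT id.
  by rewrite monicE lead_coefE size_prod_XsubC s1 => /eqP.
have [->|jn] := eqVneq j n.
  have := @coefPn_prod_XsubC F rs; have := @coefPn_prod_XsubC F ts.
  by rewrite sr st => -> // -> //; rewrite e subrr.
have [->|jn1] := eqVneq j n.+1; first by rewrite !lead// subrr.
have jl : (n.+2 <= j)%N by lia.
by rewrite !nth_default ?subrr// size_prod_XsubC ?sr ?st.
Qed.

End Lagrange.

Section SmallRoot.
Variable R : realType.
Implicit Types (t l : R).

(** The root of [l + 1 / l = t] in the open unit disk, for [t < -2]. *)
Definition small_root t := (t + Num.sqrt (t ^+ 2 - 4)) / 2.

Lemma small_rootP t : t < -2 ->
  -1 < small_root t < 0 /\ small_root t + (small_root t)^-1 = t.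
Proof.
move=> t2; have d0 : 0 <= t ^+ 2 - 4 by nra.
have s2 := sqr_sqrtr d0; have s0 := sqrtr_ge0 (t ^+ 2 - 4).
rewrite /small_root; move: (Num.sqrt _) s2 s0 => s s2 s0.
have st : s < - t by rewrite -(@ltr_pXn2r _ 2) ?nnegrE ?s2//; [nra|lra].
have st2 : - t - 2 < s.
  by rewrite -(@ltr_pXn2r _ 2) ?nnegrE ?s2//; [nra|lra].
split; first by lra.
have ts0 : t + s != 0 by rewrite lt_eqF//; lra.
have [two0 tsE] : 2 != 0 :> R /\ (t + s) ^+ 2 + 4 = 2 * t * (t + s).
  by split => //; nra.
apply/eqP; rewrite -subr_eq0; apply/eqP.
transitivity (((t + s) ^+ 2 + 4 - 2 * t * (t + s)) / (2 * (t + s))).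
  by field.
by rewrite tsE subrr mul0r.
Qed.

End SmallRoot.

(** * Partial fractions of the symbol *)

Section DiscreteOperator.
Variables (R : realType) (h : R) (n : nat) (k : R) (ts : seq R).
Hypothesis n3 : (n < 3)%N.
Hypothesis k0 : k != 0.
Hypothesis size_ts : size ts = n.
Hypothesis uniq_ts : uniq ts.
Hypothesis ts_lt : forall t, t \in ts -> t < -2.
Hypothesis QE : Qpoly h n.+1 = k *: \prod_(t <- ts) ('X - t%:P).

Local Notation P := (Ppoly h n.+1).
Local Notation e := (expR h).
Local Notation lam := (@small_root R).

Let inner := map lam ts.
Let outer := map (fun t => (lam t)^-1) ts.

Lemma small_root_neq0 t : t \in ts -> lam t != 0.
Proof. by move=> /ts_lt /small_rootP[/andP[_ l0] _]; rewrite lt_eqF. Qed.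

Lemma Ppoly_prod : P = k *: \prod_(t <- ts) ('X ^+ 2 - t *: 'X + 1).
Proof.
apply: poly_eq_gt1 => x x1; have x0 : x != 0 by rewrite gt_eqF//; lra.
rewrite Ppoly_sym//.
rewrite QE !hornerZ mulrCA; congr (_ * _); rewrite !horner_prod -size_ts.
elim: (ts) => [|t s IH]; first by rewrite !big_nil mulr1.
rewrite !big_cons /= -IH exprS mulrACA; congr (_ * _).
by rewrite !hornerE; field.
Qed.

Lemma Ppoly_split : P = k *: \prod_(r <- inner ++ outer) ('X - r%:P).
Proof.
rewrite Ppoly_prod big_cat /inner /outer /= !big_map -big_split /=; congr (_ *: _).
rewrite !big_seq; apply: eq_bigr => t tts.
have [_ lt] := small_rootP (ts_lt tts); have l0 := small_root_neq0 tts.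
by rewrite -[in LHS]lt; apply: poly_eq_gt1 => x _; rewrite !hornerE /=; field.
Qed.

Lemma size_roots : size (inner ++ outer) = (2 * n)%N.
Proof. by rewrite size_cat !size_map size_ts mul2n addnn. Qed.

Lemma plead_split : plead h n.+1 = k.
Proof.
rewrite /plead Ppoly_split coefZ (_ : 2 * n.+1 - 2 = 2 * n)%N; last by lia.
have := monic_prod_XsubC (inner ++ outer) predT id.
rewrite monicE lead_coefE size_prod_XsubC size_roots => /eqP ->.
by rewrite mulr1.
Qed.

Lemma sum_roots : \sum_(r <- inner ++ outer) r = \sum_(t <- ts) t.
Proof.
rewrite big_cat /inner /outer /= !big_map -big_split /= big_seq [RHS]big_seq.
by apply: eq_bigr => t /ts_lt /small_rootP[].
Qed.

Lemma Cconst_split : Cconst h n.+1 =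
  e * (2 * coshR h + (2 * n)%:R - \sum_(t <- ts) t).
Proof.
rewrite /Cconst plead_split (_ : 2 * n.+1 - 2 = 2 * n)%N; last by lia.
have -> : (if n.+1 == 1%N then 0 else P`_(2 * n.+1 - 3)) =
    - k * \sum_(t <- ts) t.
  case: ifP => [/eqP[n0]|n0].
    by move: size_ts; rewrite n0 => /size0nil ->; rewrite big_nil mulr0.
  rewrite Ppoly_split coefZ (_ : 2 * n.+1 - 3 = (2 * n).-1)%N; last by lia.
  rewrite -size_roots coefPn_prod_XsubC ?size_roots; last by lia.
  by rewrite sum_roots; ring.
have := coshR_expR h; move: (\sum_(t <- ts) t) (expR (2 * h)) => S E E1.
by apply: (@addrI _ (- (E + 1))); rewrite [in RHS]E1; field.
Qed.

Lemma inner_roots_split :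
  perm_eq (inner_roots h n.+1) (map (real_complex R) inner).
Proof.
rewrite /inner_roots; case: closed_field_poly_normal => s /= Es.
have PE : PpolyC h n.+1 =
    k%:C *: \prod_(z <- map (real_complex R) (inner ++ outer)) ('X - z%:P).
  rewrite /PpolyC Ppoly_split map_polyZ rmorph_prod big_map.
  by congr (_ *: _); apply: eq_bigr => r _; rewrite rmorphB /= map_polyX map_polyC.
have k0' : k%:C != 0 by rewrite fmorph_eq0.
have lE : lead_coef (PpolyC h n.+1) = k%:C.
  rewrite PE lead_coefZ (eqP (monic_prod_XsubC _ _ _)) mulr1//.
have /perm_filter : perm_eq s (map (real_complex R) (inner ++ outer)).
  apply: prod_XsubC_eq; apply: (can_inj (scalerK k0')).
  by rewrite -PE -[in LHS]lE.
move=> /(_ (fun z => `|z| < 1)) /perm_trans; apply.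
rewrite map_cat filter_cat (_ : [seq z <- map (real_complex R) outer | `|z| < 1] = [::]); last first.
  apply/eqP; rewrite -[_ == _]negbK -has_filter -all_predC.
  apply/allP => _ /mapP[_ /mapP[t tts ->] ->] /=.
  have [/andP[l1 l0] _] := small_rootP (ts_lt tts).
  rewrite normc_def /= expr0n addr0 sqrtr_sqr ltcR -leNgt normfV.
  by rewrite invf_ge1 ?normr_gt0 ?lt_eqF// ltr0_norm//; lra.
rewrite cats0 (_ : [seq z <- _ | _] = map (real_complex R) inner)//.
apply/all_filterP/allP => _ /mapP[_ /mapP[t tts ->] ->].
have [/andP[l1 l0] _] := small_rootP (ts_lt tts).
by rewrite normc_def /= expr0n addr0 sqrtr_sqr ltcR ltr0_norm//; lra.
Qed.

Definition Areal (l : R) : R :=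
  2 * (1 - l) ^+ (2 * n) * (l * (expR (2 * h) + 1) - e * (l ^+ 2 + 1)) * k
  / (l * P^`().[l]).

Lemma Acoef_real (l : R) : Acoef h n.+1 l%:C = (Areal l)%:C.
Proof.
rewrite /Acoef /PpolyC deriv_map horner_map plead_split /Areal.
rewrite (_ : 2 * n.+1 - 2 = 2 * n)%N; last by lia.
rewrite fmorph_div !rmorphM rmorphXn !rmorphB !rmorphM.
by rewrite (rmorphD _ (l ^+ 2)) rmorphXn rmorph1 rmorph_nat.
Qed.

(** Only the factor that vanishes at the root contributes to the derivative; the
    remaining factors [l ^ 2 - u * l + 1] are [l * (t - u)]. *)
Lemma deriv_Ppoly_small_root t : t \in ts ->
  P^`().[lam t] =
  k * (lam t - (lam t)^-1) * (lam t ^+ n.-1 * (others ts t).[t]).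
Proof.
move=> tts; have [_ lt] := small_rootP (ts_lt tts).
have l0 := small_root_neq0 tts; move: (lam t) lt l0 => l lt l0.
rewrite Ppoly_prod (bigD1_seq t)//= derivZ derivM hornerZ -mulrA.
congr (_ * _); rewrite hornerD !hornerM.
have -> : ('X ^+ 2 - t *: 'X + 1).[l] = 0 by rewrite !hornerE -lt; field.
rewrite mul0r addr0; congr (_ * _).
  by rewrite !poly.derivE !hornerE /= -lt; field.
have <- : size (rem t ts) = n.-1 by rewrite size_rem// size_ts.
have remE (F : R -> R) :
    \prod_(u <- ts | u != t) F u = \prod_(u <- rem t ts) F u.
  by rewrite rem_filter// big_filter.
rewrite /others !horner_prod !remE.
elim: (rem t ts) => [|u s IH]; first by rewrite !big_nil mulr1.
rewrite !big_cons /= IH [l ^+ _.+1]exprS [RHS]mulrACA; congr (_ * _).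
by rewrite !hornerE -lt; field.
Qed.

(** Up to the factor [l - 1 / l], the fundamental solution of [T - (l + 1 / l)]
    that decays when [|l| < 1]. *)
Definition expseq (l : R) : int -> R := fun b => l ^+ `|b|%N.

Lemma expseq_sshift l : l != 0 ->
  act ('X - (l + l^-1)%:P) (expseq l) = (l - l^-1) *: delta0 R.
Proof.
move=> l0; rewrite actB actX actC; apply/funext => b.
rewrite !fctE /sshift /expseq /delta0 /GRing.scale /=.
have [->|b0] := eqVneq b 0; first by rewrite add0r sub0r /= !expr1; ring.
have [c cE] : exists c, `|b|%N = c.+1 by exists `|b|.-1; lia.
rewrite mulr0 cE.
have -> : (l ^+ `|b + 1| + l ^+ `|b - 1|)%R = l ^+ c.+2 + l ^+ c.
  case: (ltP 0 b) => b1; first by congr (_ ^+ _ + _ ^+ _); lia.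
  by rewrite [LHS]addrC; congr (_ ^+ _ + _ ^+ _); lia.
by rewrite !exprS; field.
Qed.

(** The three cases of the definition of [Dm] are those of a linear combination
    of the sequences [expseq] corrected at [|b| <= 1]. *)
Lemma Dm_split : Dm h n.+1 = k^-1 *:
  (act ((2 * Cconst h n.+1)%:P - (2 * e) *: 'X) (delta0 R)
   + \sum_(t <- ts) (Areal (lam t) / lam t) *: expseq (lam t)).
Proof.
have sumE (F : R[i] -> R[i]) (G : R -> R) :
    (forall l, l \in inner -> F l%:C = (G l)%:C) ->
    \sum_(l <- inner_roots h n.+1) F l = (\sum_(t <- ts) G (lam t))%:C.
  move=> FG; rewrite (perm_big _ inner_roots_split) /= !big_map rmorph_sum.
  by rewrite !big_seq; apply: eq_bigr => t tts; rewrite FG ?map_f.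
apply/funext => b; apply: complexI; rewrite Dm_real /DmC plead_split.
rewrite [RHS]rmorphM; congr (_ * _).
rewrite actB actC actZ actX !fctE fct_sumE.
rewrite /sshift /delta0 /expseq /GRing.scale /=.
case: ifP => b2.
  have -> : (b == 0) = false by lia.
  have -> : (b + 1 == 0) = false by lia.
  have -> : (b - 1 == 0) = false by lia.
  rewrite !mulr0 addr0 mulr0 subrr add0r.
  rewrite (@sumE _ (fun l => Areal l / l * l ^+ `|b|%N))// => l.
  move=> /mapP[t /small_root_neq0 l0 ->].
  rewrite Acoef_real -rmorphXn -rmorphM /=; congr (_ %:C).
  have -> : `|b|%N = (`|b| - 1).+1%N by lia.
  by rewrite subn1 /= exprS mulrA divfK.
case: ifP => b1.
  have -> : (b == 0) = false by lia.
  rewrite mulr0 sub0r rmorphD; congr (_ + _).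
    have [->|->] : b = 1 \/ b = -1 by lia.
      by congr (_ %:C); rewrite /=; ring.
    by congr (_ %:C); rewrite /=; ring.
  rewrite (@sumE _ (fun l => Areal l / l * l ^+ `|b|%N))// => l.
  move=> /mapP[t /small_root_neq0 l0 ->].
  by rewrite Acoef_real (eqP b1) divfK.
have -> : b = 0 by lia.
rewrite rmorphD; congr (_ + _); first by congr (_ %:C); rewrite /=; ring.
rewrite (@sumE _ (fun l => Areal l / l * l ^+ `|0|%N))// => l _.
by rewrite Acoef_real -[`|0|%N]/0%N expr0 mulr1 -fmorph_div.
Qed.

(** Up to the constant [k], these are the residues of [Npoly / Qpoly] at its
    poles. *)
Lemma Areal_residue t : t \in ts ->
  Areal (lam t) / lam t * (lam t - (lam t)^-1) =
  (Npoly h n.+1).[t] / (others ts t).[t].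
Proof.
move=> tts; rewrite /Areal deriv_Ppoly_small_root// coshR_expR.
have [/andP[l1 l2] lt] := small_rootP (ts_lt tts).
have l0 := small_root_neq0 tts; have w0 := others_neq0 ts t.
have l1' : lam t * lam t - 1 != 0 by rewrite lt_eqF//; nra.
rewrite /Npoly !hornerE /=.
have nE : n = n.-1.+1 by case: (ts) tts size_ts => //= ? ? _ <-.
have -> : (1 - lam t) ^+ (2 * n) = lam t ^+ n * (t - 2) ^+ n.
  rewrite exprM -exprMn; congr (_ ^+ _).
  have lt2 : lam t * t = lam t ^+ 2 + 1 by rewrite -{2}lt; field.
  by rewrite mulrBr lt2; ring.
rewrite [in lam t ^+ n]nE exprS.
move: (_.[t]) w0 (lam t) lt l0 l1' => w w0 l lt l0 l1'.
have p0 : l ^+ n.-1 != 0 by rewrite expf_neq0.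
move: (l ^+ n.-1) p0 => p p0; move: ((t - 2) ^+ n) => y.
by rewrite -lt; field; rewrite ?w0 ?p0 ?l0 ?k0 ?l1'.
Qed.

(** After multiplication by the denominator, this is the decomposition of
    [Npoly] into its polynomial part and its Lagrange interpolant at the roots.
    The constant [Cconst] is the one for which the polynomial part leaves a
    remainder of degree less than the number of roots. *)
Lemma symbol_Dm :
  act (\prod_(t <- ts) ('X - t%:P)) (Dm h n.+1) =
  act (k^-1 *: Npoly h n.+1) (delta0 R).
Proof.
set W := \prod_(t <- ts) _; rewrite Dm_split actZr actZ actDr.
rewrite [act W (\sum_(t <- ts) _)]act_sumr.
congr (_ *: _); set L := _ - _ *: 'X.
have -> : \sum_(t <- ts) act W ((Areal (lam t) / lam t) *: expseq (lam t)) =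
    \sum_(t <- ts) act (((Npoly h n.+1).[t] / (others ts t).[t]) *: others ts t)
      (delta0 R).
  rewrite !big_seq; apply: eq_bigr => t tts.
  have l0 := small_root_neq0 tts; have [_ lt] := small_rootP (ts_lt tts).
  have := expseq_sshift l0; rewrite lt => expE.
  have -> : W = others ts t * ('X - t%:P).
    by rewrite /W (bigD1_seq t)//= mulrC.
  rewrite actZr actM expE actZ actZr scalerA.
  by rewrite -Areal_residue.
rewrite -act_suml -actM -actD; congr (act _ _).
have -> : \sum_(t <- ts) ((Npoly h n.+1).[t] / (others ts t).[t]) *: others ts t
    = Npoly h n.+1 - W * L; last by ring.
(* the polynomial part is a multiple of [W], so interpolation ignores it *)
have L0 t : t \in ts -> (W * L).[t] = 0.
  move=> tts; rewrite hornerM /W horner_prod (bigD1_seq t)//= hornerXsubC.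
  by rewrite subrr !mul0r.
rewrite -[RHS](@lagrange _ ts)//.
  rewrite !big_seq; apply: eq_bigr => t tts.
  by rewrite hornerD hornerN L0// subr0.
have e0 : e != 0 by rewrite gt_eqF// expR_gt0.
have -> : W * L = (- 2 * e) *:
    \prod_(r <- (Cconst h n.+1 / e) :: ts) ('X - r%:P).
  rewrite big_cons scalerAl mulrC; congr (_ * _).
  by apply: poly_eq_gt1 => x _; rewrite !hornerE; field.
have -> : Npoly h n.+1 = (- 2 * e) *:
    \prod_(r <- (2 * coshR h) :: nseq n 2) ('X - r%:P).
  by rewrite /Npoly big_cons big_nseq iter_mulr_1 [('X - _) * _]mulrC.
rewrite -scalerBr; apply: (leq_trans (size_scale_leq _ _)); rewrite size_ts.
apply: size_sub_prod_XsubC; rewrite /= ?size_nseq ?size_ts//.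
rewrite !big_cons big_nseq iter_addr_0 Cconst_split.
by rewrite natrM -mulr_natr; field.
Qed.

End DiscreteOperator.

(** * Sequences on the grid *)

Section Grid.
Variables (R : realType) (h : R).
Hypothesis h0 : 0 < h.
Implicit Types (x y M : R) (b c : int) (q : {poly R}) (D f : int -> R).

Lemma norm_grid b : `|h * b%:~R| = h * `|b|%N%:R.
Proof. by rewrite normrM gtr0_norm// natr_absz intr_norm. Qed.

Lemma expR_norm_grid b : expR `|h * b%:~R| = expR h ^+ `|b|%N.
Proof. by rewrite norm_grid expRM_natr. Qed.

Lemma exprn_le_expR x i : 0 <= x -> x ^+ i <= i`!%:R * expR x.
Proof.
move=> x0; case: i => [|i].
  by rewrite expr0 fact0 mul1r; have := expR_ge1Dx x; lra.
by rewrite mulrC -ler_pdivrMr ?ltr0n ?fact_gt0//; have := expR_ge1Dxn i x0; lra.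
Qed.

(** Each power is dominated by [expR (ln x * |b|)]. *)
Lemma poly_growth q x : 1 < x ->
  exists M, forall b, `|atgrid h (horner q) b| <= M * x ^+ `|b|%N.
Proof.
move=> x1; have a0 : 0 < ln x by rewrite ln_gt0.
have xE b : x ^+ `|b|%N = expR (ln x * `|b|%N%:R).
  by rewrite expRM_natr lnK// posrE; lra.
exists (\sum_(i < size q) `|q`_i| * ((h / ln x) ^+ i * i`!%:R)) => b.
rewrite /atgrid horner_coef mulr_suml; apply: (le_trans (ler_norm_sum _ _ _)).
apply: ler_sum => i _; rewrite normrM normrX norm_grid -mulrA ler_wpM2l//.
have -> : h * `|b|%N%:R = h / ln x * (ln x * `|b|%N%:R).
  by rewrite mulrA divfK// gt_eqF.
have q0 : 0 <= (h / ln x) ^+ i by rewrite exprn_ge0// divr_ge0// ltW.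
rewrite exprMn -mulrA ler_wpM2l// xE.
by apply: exprn_le_expR; rewrite mulr_ge0// ltW.
Qed.

(** The operator [T - 2] is the second difference, which lowers the degree of
    a polynomial by two. *)
Lemma second_difference q : exists2 q2 : {poly R},
  (size q2 <= size q - 2)%N &
  act ('X - 2%:P) (atgrid h (horner q)) = atgrid h (horner q2).
Proof.
(* the Taylor expansions at [h] and [- h], whose terms of index 0 and 1 cancel *)
exists (\sum_(2 <= i < size q) (h ^+ i + (- h) ^+ i) *: q^`N(i)).
  rewrite big_nat; apply: (big_ind (fun p : {poly R} => (size p <= size q - 2)%N)).
  - by rewrite size_poly0.
  - by move=> p r sp sr; rewrite (leq_trans (size_polyD _ _))// geq_max sp.
  - move=> i /andP[i2 _]; apply: (leq_trans (size_scale_leq _ _)).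
    by apply: (leq_trans (size_poly _ _)); exact: leq_sub2l.
rewrite actB actX actC; apply/funext => b.
rewrite !fctE /sshift /atgrid /GRing.scale /= rmorphD rmorphB /= mulrDr mulrBr.
rewrite mulr1; move: (h * _) => x.
rewrite !(@nderiv_taylor _ q x); [|exact: mulrC..].
rewrite -big_split /= horner_sum -(big_mkord xpredT
  (fun i => q^`N(i).[x] * h ^+ i + q^`N(i).[x] * (- h) ^+ i)).
case s: (size q) => [|[|s']].
- have -> : q = 0 by apply/eqP; rewrite -size_poly_eq0 s.
  by rewrite horner0 !big_geq//; ring.
- rewrite big_nat1 big_geq// nderivn0; ring.
- rewrite big_ltn// big_ltn// nderivn0 expr0 expr1 mulrN subrr add0r !mulr1.
  rewrite [LHS](_ : _ = \sum_(2 <= i < s'.+2)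
    (q^`N(i).[x] * h ^+ i + q^`N(i).[x] * (- h) ^+ i)); last by ring.
  by apply: eq_bigr => i _; rewrite hornerZ; ring.
Qed.

Lemma differences_kill n q : (size q <= 2 * n)%N ->
  act (('X - 2%:P) ^+ n) (atgrid h (horner q)) = 0.
Proof.
elim: n q => [|n IH] q sq.
  have -> : q = 0 by apply/eqP; rewrite -size_poly_eq0; lia.
  rewrite (_ : atgrid _ _ = 0) ?act0r//.
  by apply/funext => b; rewrite /atgrid horner0.
have [q2 s2 qE] := second_difference q.
by rewrite exprS mulrC actM qE IH//; lia.
Qed.

Lemma sshift_expR :
  sshift (atgrid h (fun x => expR x)) =
  (2 * coshR h) *: atgrid h (fun x => expR x).
Proof.
apply/funext => b; rewrite fctE /sshift /atgrid /coshR /GRing.scale /=.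
by rewrite rmorphD rmorphB /= mulrDr mulrBr mulr1 !expRD; field.
Qed.

Lemma sshift_expRN :
  sshift (atgrid h (fun x => expR (- x))) =
  (2 * coshR h) *: atgrid h (fun x => expR (- x)).
Proof.
apply/funext => b; rewrite fctE /sshift /atgrid /coshR /GRing.scale /=.
rewrite rmorphD rmorphB /= mulrDr mulrBr mulr1 opprD opprB [h - _]addrC !expRD.
by field.
Qed.

(** * The fundamental solution on the grid *)

Definition signed (G : R -> R) : int -> R :=
  fun b => Num.sg b%:~R * G (h * b%:~R).

(** Away from the origin the sign is constant on the three points involved, the
    value of [G] at 0 being 0; at the origin the two neighbours of an odd
    function add up instead of cancelling. *)
Lemma sshift_signed (G H : R -> R) t :
  (forall x, G (- x) = - G x) ->
  (forall x, G (x + h) + G (x - h) = t * G x + H x) ->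
  act ('X - t%:P) (signed G) = signed H + (2 * G h) *: delta0 R.
Proof.
move=> Godd GH; have G0 : G 0 = 0 by have := Godd 0; rewrite oppr0; lra.
have sP (F : R -> R) b : F 0 = 0 \/ b != 0 -> 0 <= b ->
    signed F b = F (h * b%:~R).
  rewrite le_eqVlt /signed => F0 /orP[/eqP b0|b0].
    by case: F0; rewrite -b0 ?eqxx// mulr0 => ->; rewrite mulr0.
  by rewrite gtr0_sg ?ltr0z// mul1r.
have sN (F : R -> R) b : F 0 = 0 \/ b != 0 -> b <= 0 ->
    signed F b = - F (h * b%:~R).
  rewrite le_eqVlt /signed => F0 /orP[/eqP b0|b0].
    by case: F0; rewrite b0 ?eqxx// mulr0 => ->; rewrite mulr0 oppr0.
  by rewrite ltr0_sg ?ltrz0// mulN1r.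
rewrite actB actX actC; apply/funext => b; rewrite !fctE /sshift /delta0.
rewrite /GRing.scale /=.
have hS : h * (b + 1)%:~R = h * b%:~R + h by rewrite rmorphD mulrDr mulr1.
have hP : h * (b - 1)%:~R = h * b%:~R - h by rewrite rmorphB mulrBr mulr1.
have [b0|b0|b0] := ltrgt0P b.
- rewrite (sP G (b + 1)) ?(sP G (b - 1)) ?(sP G b) ?(sP H b); try by [lia|left|right; lia].
  rewrite hS hP mulr0.
  by have := GH (h * b%:~R); lra.
- rewrite (sN G (b + 1)) ?(sN G (b - 1)) ?(sN G b) ?(sN H b); try by [lia|left|right; lia].
  rewrite hS hP mulr0.
  by have := GH (h * b%:~R); lra.
- rewrite b0 add0r sub0r (sP G 1); try by [left|lia].
  rewrite (sN G (-1)); try by [left|lia].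
  rewrite /signed sgr0 !mul0r mulr1 mulrN1 Godd -[true%:R]/1; lra.
Qed.

Lemma signed_sinhR :
  act ('X - (2 * coshR h)%:P) (signed (@sinhR R)) =
  (2 * sinhR h) *: delta0 R.
Proof.
rewrite (@sshift_signed _ (fun=> 0)).
- rewrite (_ : signed (fun=> 0) = 0) ?add0r//.
  by apply/funext => b; rewrite /signed mulr0.
- by move=> x; rewrite /sinhR opprK; field.
- by move=> x; rewrite /sinhR /coshR opprD opprB [h - x]addrC !expRD; field.
Qed.

Lemma signed_id :
  act ('X - 2%:P) (signed id) = (2 * h) *: delta0 R.
Proof.
rewrite (@sshift_signed _ (fun=> 0)) //; last by move=> x; ring.
rewrite (_ : signed (fun=> 0) = 0) ?add0r//.
by apply/funext => b; rewrite /signed mulr0.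
Qed.

Lemma signed_cube :
  act ('X - 2%:P) (signed (fun x => x ^+ 3)) =
  (6 * h ^+ 2) *: signed id + (2 * h ^+ 3) *: delta0 R.
Proof.
rewrite (@sshift_signed _ (fun x => 6 * h ^+ 2 * x)).
- congr (_ + _); apply/funext => b; rewrite fctE /signed /GRing.scale /=; ring.
- by move=> x; ring.
- by move=> x; ring.
Qed.

Definition taylor_part n : {poly R} :=
  \sum_(1 <= k < n.+1) ((2 * k - 1)`!%:R)^-1 *: 'X^(2 * k - 1).

Lemma psim_taylor n x :
  psim n.+1 x = Num.sg x / 2 * (sinhR x - (taylor_part n).[x]).
Proof.
rewrite /psim /taylor_part horner_sum; congr (_ * (_ - _)).
by apply: eq_bigr => k _; rewrite hornerZ hornerXn mulrC.
Qed.

Lemma psim_signed n : atgrid h (psim n.+1) =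
  2^-1 *: (signed (@sinhR R) - signed (horner (taylor_part n))).
Proof.
apply/funext => b; rewrite !fctE /atgrid psim_taylor /signed /GRing.scale /=.
by rewrite sgrM gtr0_sg// mul1r; ring.
Qed.

Lemma taylor_partE n x : (n < 3)%N -> (taylor_part n).[x] =
  match n with 0 => 0 | 1 => x | _ => x + x ^+ 3 / 6 end.
Proof.
rewrite /taylor_part; case: n => [|[|[|]]]// _.
- by rewrite big_geq// horner0.
- by rewrite big_nat1 -[(2 * 1 - 1)%N]/1%N -[1`!]/1%N !hornerE; field.
- rewrite big_nat_recr// big_nat1 /= -[(2 * 1 - 1)%N]/1%N -[1`!]/1%N.
  by rewrite -[(2 * 2 - 1)%N]/3%N -[3`!]/6%N !hornerE /=; field.
Qed.

(** [Upoly] encodes what the differences of the odd powers leave at the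
    origin. *)
Lemma signed_taylor_part n : (n < 3)%N ->
  act (('X - 2%:P) ^+ n) (signed (horner (taylor_part n))) =
  act (2 *: Upoly h n.+1) (delta0 R).
Proof.
move=> n3; have tE : horner (taylor_part n) =
    (fun x => match n with 0 => 0 | 1 => x | _ => x + x ^+ 3 / 6 end).
  by apply/funext => x; rewrite taylor_partE.
rewrite {}tE; case: n n3 => [|[|[|]]]// _.
- rewrite expr0 act1 actZ -[Upoly h 1]/(0%:P) actC scale0r scaler0.
  by apply/funext => b; rewrite /signed mulr0.
- by rewrite expr1 signed_id actZ actC scalerA.
- rewrite (_ : signed _ = signed id + 6^-1 *: signed (fun x => x ^+ 3)).
    rewrite expr2 actM actDr actZr signed_id signed_cube !actDr !actZr.
    rewrite actDr !actZr signed_id /= !scalerDr -!actC -!actM -!actD.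
    by congr (act _ _); apply: poly_eq_gt1 => x _; rewrite !hornerE /=; field.
  by apply/funext => b; rewrite !fctE /signed /GRing.scale /=; ring.
Qed.

Lemma symbol_psim n : (n < 3)%N ->
  act (Npoly h n.+1) (atgrid h (psim n.+1)) = act (Qpoly h n.+1) (delta0 R).
Proof.
move=> n3; rewrite psim_signed actZr actBr /Npoly /= !actZ.
have swap p q f : act (p * q) f = act q (act p f) by rewrite mulrC actM.
rewrite actM signed_sinhR swap signed_taylor_part// actZr -actM.
rewrite -!actZ -actB -actZ; congr (act _ _).
rewrite /Qpoly /=; apply: poly_eq_gt1 => x _.
move: (sinhR h) (coshR h) (expR h) (Upoly h n.+1) => s c e u.
by rewrite !hornerE /=; field.
Qed.

End Grid.

(** * Convolutions with the discrete operator *)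

Section PsimBounds.
Variable R : realType.
Implicit Types x : R.

Lemma sinhRN x : sinhR (- x) = - sinhR x.
Proof. by rewrite /sinhR opprK; field. Qed.

Lemma taylor_partN n x : (n < 3)%N ->
  (taylor_part R n).[- x] = - (taylor_part R n).[x].
Proof.
by move=> n3; rewrite !taylor_partE//; case: n n3 => [|[|[|]]]// _; ring.
Qed.

Lemma psimN n x : (n < 3)%N -> psim n.+1 (- x) = psim n.+1 x.
Proof.
by move=> n3; rewrite !psim_taylor sgrN sinhRN taylor_partN//; ring.
Qed.

Lemma taylor_part_bounds n x : (n < 3)%N -> 0 <= x ->
  0 <= (taylor_part R n).[x] <= x + x ^+ 3 / 6.
Proof.
move=> n3 x0; have x3 : 0 <= x ^+ 3 by rewrite exprn_ge0.
by rewrite taylor_partE//; case: n n3 => [|[|[|]]]// _; lra.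
Qed.

Lemma psim_le_expR n x : (n < 3)%N -> `|psim n.+1 x| <= 2 * expR `|x|.
Proof.
move=> n3; wlog x0 : x / 0 <= x.
  move=> H; case: (leP 0 x) => [/H//|x0].
  by rewrite -psimN// -(normrN x); apply: H; lra.
have /andP[p0 p1] := taylor_part_bounds n3 x0.
rewrite psim_taylor (ger0_norm x0) normrM normf_div (gtr0_norm (_ : 0 < 2 :> R))//.
have sg1 : `|Num.sg x| <= 1 by rewrite normr_sg; case: eqP.
have G : `|sinhR x - (taylor_part R n).[x]| <= 4 * expR x.
  have e3 := exprn_le_expR 3 x0; have e1 := exprn_le_expR 1 x0.
  have eN : expR (- x) <= expR x by rewrite ler_expR; lra.
  have eN0 := expR_gt0 (- x).
  rewrite -[3`!]/6%N -[1`!]/1%N expr1 in e3 e1.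
  by rewrite ler_norml /sinhR; lra.
have := ler_pM (normr_ge0 _) (normr_ge0 _) sg1 G; lra.
Qed.

(** The fundamental solution grows like [expR `|x| / 4]; the constant absorbs the
    polynomial part and the values near the origin. *)
Lemma expR_le_psim n x : (n < 3)%N -> expR `|x| <= 1000 + 8 * psim n.+1 x.
Proof.
move=> n3; wlog x0 : x / 0 <= x.
  move=> H; case: (leP 0 x) => [/H//|x0].
  by rewrite -psimN// -(normrN x); apply: H; lra.
have /andP[p0 p1] := taylor_part_bounds n3 x0.
rewrite psim_taylor (ger0_norm x0).
have [->|xn0] := eqVneq x 0.
  by rewrite sgr0 expR0; lra.
have {xn0} x0' : 0 < x by rewrite lt_def xn0.
rewrite gtr0_sg// /sinhR.
have eN : expR (- x) <= 1 by rewrite -expR0 ler_expR; lra.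
have e4 := exprn_le_expR 4 x0; rewrite -[4`!]/24%N in e4.
(* the quartic [x ^ 4 / 24 - 2 / 3 * x ^ 3 - 4 * x + 998] is a positive
   combination of these squares and a constant *)
have := sqr_ge0 (x ^+ 2 - 8 * x - 40); have := sqr_ge0 (x - 23).
lra.
Qed.

Lemma norm_odd_part n x : (n < 3)%N ->
  `|sinhR x - (taylor_part R n).[x]| = 2 * `|psim n.+1 x|.
Proof.
move=> n3; rewrite psim_taylor normrM normf_div normr_sg.
rewrite (gtr0_norm (_ : 0 < 2 :> R))//.
have [->|x0] := eqVneq x 0; last by rewrite /= mul1r; field.
rewrite /sinhR oppr0 subrr mul0r taylor_partE//.
by case: n n3 => [|[|[|]]]// _; rewrite ?expr0n ?addr0 ?mul0r ?addr0 subr0 normr0; ring.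
Qed.

End PsimBounds.

Section Convolutions.
Variables (R : realType) (h : R) (n : nat) (k : R) (ts : seq R).
Hypothesis h0 : 0 < h.
Hypothesis n3 : (n < 3)%N.
Hypothesis k0 : k != 0.
Hypothesis size_ts : size ts = n.
Hypothesis uniq_ts : uniq ts.
Hypothesis ts_lt : forall t, t \in ts -> t < -2.
Hypothesis QE : Qpoly h n.+1 = k *: \prod_(t <- ts) ('X - t%:P).

Local Notation D := (Dm h n.+1).
Local Notation W := (\prod_(t <- ts) ('X - t%:P)).
Local Notation N := (Npoly h n.+1).
Local Notation lam := (@small_root R).

Let symbolD := symbol_Dm n3 k0 size_ts uniq_ts ts_lt QE.

Lemma Dm_weight (x : R) : 0 <= x ->
  (forall t, t \in ts -> `|lam t| * x < 1) ->
  abs_cvgZ (fun c => D c * x ^+ `|c|%N).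
Proof.
move=> x0 lx; rewrite (Dm_split n3 k0 size_ts uniq_ts ts_lt QE).
have wS (f g : int -> R) : abs_cvgZ (fun c => f c * x ^+ `|c|%N) ->
    abs_cvgZ (fun c => g c * x ^+ `|c|%N) ->
    abs_cvgZ (fun c => (f + g) c * x ^+ `|c|%N).
  move=> cf cg; apply: eq_abs_cvgZ (abs_cvgZD cf cg) => c.
  by rewrite fctE mulrDl.
have wZ a (f : int -> R) : abs_cvgZ (fun c => f c * x ^+ `|c|%N) ->
    abs_cvgZ (fun c => (a *: f) c * x ^+ `|c|%N).
  by move=> cf; apply: eq_abs_cvgZ (abs_cvgZZ a cf) => c; rewrite fctE mulrA.
apply: (wZ); apply: (wS).
  rewrite actB actC actZ actX -scaleNr.
  have c0 (F : int -> R) : abs_cvgZ (fun c => delta0 R c * F c).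
    by apply: abs_cvgZ_single => c; rewrite /delta0 => /negbTE ->; rewrite mul0r.
  apply: (wS); first by apply: (wZ); exact: c0.
  apply: (wZ).
  have cS := (abs_cvgZ_succ _).1 (c0 (fun c => x ^+ `|(c - 1)%R|%N)).
  have cP := abs_cvgZ_pred (c0 (fun c => x ^+ `|(c + 1)%R|%N)).
  apply: eq_abs_cvgZ (abs_cvgZD cS cP) => c.
  by rewrite /sshift addrK subrK mulrDl.
elim: (ts) lx => [|t s IH] lx.
  by rewrite big_nil; apply: eq_abs_cvgZ (abs_cvgZ0 R) => c; rewrite mul0r.
rewrite big_cons; apply: (wS); last first.
  by apply: IH => u us; apply: lx; rewrite inE us orbT.
apply: (wZ); apply: (@eq_abs_cvgZ _ (fun c => (lam t * x) ^+ `|c|%N)).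
  by move=> c; rewrite exprMn.
by apply: abs_cvgZ_geometric; rewrite normrM (ger0_norm x0) lx// inE eqxx.
Qed.

(** A rate above 1 that is admissible both for the injectivity of the factors
    [T - t] and, by [small_root_rate], for the summability of [Dm]. *)
Lemma growth_rate : exists2 x : R, 1 < x & forall t, t \in ts -> 2 * x < `|t|.
Proof.
elim: (ts) ts_lt => [|t s IH] lt; first by exists 2 => //; lra.
have [u us|x x1 xs] := IH; first by apply: lt; rewrite inE us orbT.
have t2 : t < -2 by apply: lt; rewrite inE eqxx.
exists (Num.min x ((2 - t) / 4)); first by rewrite lt_min x1; lra.
have m1 : Num.min x ((2 - t) / 4) <= x by rewrite ge_min lexx.
have m2 : Num.min x ((2 - t) / 4) <= (2 - t) / 4 by rewrite ge_min lexx orbT.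
move=> u; rewrite inE => /orP[/eqP ->|/xs us]; last by lra.
by rewrite ltr0_norm; lra.
Qed.

(** Here [|l| * |t| = l ^ 2 + 1 < 2] for the small root [l]. *)
Lemma small_root_rate (x t : R) : t \in ts -> 2 * x < `|t| -> `|lam t| * x < 1.
Proof.
move=> /ts_lt t2; have [/andP[l1 l2] lt] := small_rootP t2.
rewrite ltr0_norm; last by lra.
rewrite ltr0_norm// => xt.
have lt2 : lam t * t = lam t ^+ 2 + 1.
  by rewrite -{2}lt mulrDr mulfV ?lt_eqF//; ring.
have l3 : lam t ^+ 2 < 1 by nra.
have : - lam t * (2 * x) < - lam t * - t by rewrite ltr_pM2l//; lra.
by lra.
Qed.

Lemma conv_symbol (f : int -> R) : (forall b, zconv_cvg D f b) ->
  act W (zconv D f) = k^-1 *: act N f.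
Proof. by move=> cf; rewrite (zconv_symbol symbolD cf) actZ. Qed.

Lemma conv_poly (q : {poly R}) (b : int) : (size q <= 2 * n)%N ->
  zconv_cvg D (atgrid h (horner q)) b /\
  zconv D (atgrid h (horner q)) b = 0.
Proof.
move=> sq; have [x x1 xt] := growth_rate.
have [M qM] := poly_growth h0 q x1.
have cD : abs_cvgZ (fun c => D c * x ^+ `|c|%N).
  by apply: Dm_weight => [|t tts]; [lra|apply: small_root_rate => //; exact: xt].
have [cf [M' vM]] := zconv_growth (ltW x1) cD qM.
split => //; suff -> : zconv D (atgrid h (horner q)) = 0 by [].
apply: (act_prod_inj (ltW x1) xt vM); rewrite conv_symbol//.
by rewrite /Npoly actZ [_ ^+ _ * _]mulrC actM differences_kill// act0r !scaler0.
Qed.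

(** Convolution with a character multiplies it by a constant, and the symbol
    relation forces this constant to vanish. *)
Lemma conv_character (f : int -> R) (b : int) : f 0 = 1 ->
  (forall c d, f (c + d) = f c * f d) ->
  sshift f = (2 * coshR h) *: f ->
  zconv_cvg D f b -> (forall c, zconv_cvg D f c) /\ zconv D f = 0.
Proof.
move=> f0 fM fS cb.
have tr c d : (fun a => D a * f (c - a)) =
    fun a => f (c - d) * (D a * f (d - a)).
  by apply/funext => a; rewrite mulrCA -fM; congr (_ * f _); ring.
have cf c : zconv_cvg D f c by rewrite /zconv_cvg (tr c b); exact: abs_cvgZZ.
split => //.
have vE : zconv D f = zconv D f 0 *: f.
  apply/funext => c; rewrite {1}/zconv (tr c 0) sumZZ; last exact: cf.
  by rewrite subr0 fctE /GRing.scale /= mulrC.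
have := conv_symbol cf; rewrite vE actZr !(act_eigen _ fS).
have -> : N.[2 * coshR h] = 0 by rewrite hornerZ hornerM hornerXsubC subrr !mulr0.
rewrite scale0r scaler0 => /(congr1 (fun g : int -> R => g 0)).
rewrite !fctE /GRing.scale /= f0 mulr1 => /eqP; rewrite mulf_eq0 => /orP[/eqP ->|].
  by apply/funext => c; rewrite mul0r.
rewrite horner_prod prodf_seq_eq0 => /hasP[t /ts_lt t2] /=.
rewrite hornerXsubC subr_eq0 => /eqP e2; exfalso.
by have := coshR_gt0 h; lra.
Qed.

Lemma conv_expR (b : int) : zconv_cvg D (atgrid h (fun x => expR x)) b ->
  (forall c, zconv_cvg D (atgrid h (fun x => expR x)) c) /\
  zconv D (atgrid h (fun x => expR x)) = 0.
Proof.
apply: conv_character; last exact: sshift_expR.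
- by rewrite /atgrid mulr0 expR0.
- by move=> c d; rewrite /atgrid rmorphD mulrDr expRD.
Qed.

Lemma conv_expRN (b : int) : zconv_cvg D (atgrid h (fun x => expR (- x))) b ->
  (forall c, zconv_cvg D (atgrid h (fun x => expR (- x))) c) /\
  zconv D (atgrid h (fun x => expR (- x))) = 0.
Proof.
apply: conv_character; last exact: sshift_expRN.
- by rewrite /atgrid mulr0 oppr0 expR0.
- by move=> c d; rewrite /atgrid rmorphD mulrDr opprD expRD.
Qed.

Lemma conv_growth_expR (f : R -> R) (M : R) :
  abs_cvgZ (fun c => D c * expR h ^+ `|c|%N) ->
  (forall x, `|f x| <= M * expR `|x|) ->
  forall b, zconv_cvg D (atgrid h f) b.
Proof.
move=> cD fM; apply: (zconv_growth (x := expR h) (M := M) _ cD _).1.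
  by rewrite ltW// expR_gt1.
by move=> b; rewrite /atgrid -(expR_norm_grid h0).
Qed.

(** Convergence against the fundamental solution is convergence with the weight
    [expR (h * |c|)], since the fundamental solution has that growth. *)
Lemma conv_psim_weight (b : int) : zconv_cvg D (atgrid h (psim n.+1)) b ->
  abs_cvgZ (fun c => D c * expR h ^+ `|c|%N).
Proof.
move=> cb; have cD : abs_cvgZ D.
  have [x x1 xt] := growth_rate.
  apply: eq_abs_cvgZ (@Dm_weight 1 ler01 _) => [c|t tts].
    by rewrite expr1n mulr1.
  by apply: small_root_rate => //; have := xt _ tts; lra.
set E := expR `|h * b%:~R|.
have cU := abs_cvgZD (abs_cvgZZ (E * 1000) ((abs_cvgZ_norm _).1 cD))
  (abs_cvgZZ (E * 8) ((abs_cvgZ_norm _).1 cb)).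
apply: abs_cvgZ_le cU => c; rewrite normrM -(expR_norm_grid h0).
rewrite (ger0_norm (expR_ge0 _)); apply: le_trans (ler_norm _).
set p := atgrid h (psim n.+1) (b - c); rewrite /= [`|_ * p|]normrM.
have pE : expR `|h * c%:~R| <= E * (1000 + 8 * `|p|).
  apply: (@le_trans _ _ (E * expR `|h * (b - c)%:~R|)).
    rewrite /E -expRD ler_expR rmorphB mulrBr /=.
    by rewrite -[X in `|X| <= _](subKr (h * b%:~R)) ler_normB.
  rewrite ler_wpM2l ?expR_ge0//; apply: (le_trans (expR_le_psim _ n3)).
  by have := ler_norm p; rewrite /p /atgrid; lra.
have := ler_wpM2l (normr_ge0 (D c)) pE; lra.
Qed.

(** Subtracting from [psim] a multiple of the odd part [g], whose convolution
    vanishes, removes all terms of the convolution at [b] on one side of [b]. *)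
Lemma conv_psim_bounded : abs_cvgZ (fun c => D c * expR h ^+ `|c|%N) ->
  exists M, forall b, `|zconv D (atgrid h (psim n.+1)) b| <= M.
Proof.
move=> cD.
have cpsi := conv_growth_expR cD (fun x => psim_le_expR x n3).
pose g := 2^-1 *: atgrid h (fun x => expR x)
  + (- 2^-1) *: atgrid h (fun x => expR (- x))
  + (-1) *: atgrid h (horner (taylor_part R n)).
have gE : g = atgrid h (fun x => sinhR x - (taylor_part R n).[x]).
  by apply/funext => c; rewrite /g !fctE /atgrid /sinhR /GRing.scale /=; field.
have Dg b : zconv_cvg D g b /\ zconv D g b = 0.
  have [] := @conv_expR 0.
    apply: (conv_growth_expR (M := 1)) => // x.
    by rewrite mul1r ger0_norm ?expR_ge0// ler_expR ler_norm.
  have [] := @conv_expRN 0.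
    apply: (conv_growth_expR (M := 1)) => // x.
    by rewrite mul1r ger0_norm ?expR_ge0// ler_expR -normrN ler_norm.
  move=> c2 v2 c1 v1.
  have [|c3 v3] := @conv_poly (taylor_part R n) b.
    rewrite /taylor_part big_nat.
    apply: (big_ind (fun q : {poly R} => (size q <= 2 * n)%N)).
    - by rewrite size_poly0.
    - by move=> p r sp sr; rewrite (leq_trans (size_polyD _ _))// geq_max sp.
    - move=> i /andP[i1 i2]; apply: (leq_trans (size_scale_leq _ _)).
      by rewrite size_polyXn; lia.
  have [c1' v1'] := zconvZr 2^-1 (c1 b).
  have [c2' v2'] := zconvZr (- 2^-1) (c2 b).
  have [c3' v3'] := zconvZr (-1) c3.
  have [c12 v12] := zconvDr c1' c2'.
  have [c v] := zconvDr c12 c3'.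
  split; first exact: c.
  by rewrite /g v v12 v1' v2' v3' v1 v2 v3 !mulr0 !addr0.
pose w c := `|D c * expR h ^+ `|c|%N|.
have cw : abs_cvgZ w by exact: (abs_cvgZ_norm _).1 cD.
exists (4 * sumZ w) => b.
(* For the sign chosen according to that of [b], the sequence [psim + s * g]
   vanishes at [b - c] unless [|b - c| <= |c|]. *)
have half (s : R) : (forall c, `|(atgrid h (psim n.+1) + s *: g) (b - c)| <=
      4 * expR h ^+ `|c|%N) ->
    `|zconv D (atgrid h (psim n.+1)) b| <= 4 * sumZ w.
  move=> bd; have [cg vg] := zconvZr s (Dg b).1.
  have [_ v] := zconvDr (cpsi b) cg.
  rewrite -[zconv _ _ b]addr0 -(mulr0 s) -[in X in s * X](Dg b).2 -vg -v.
  rewrite -sumZZ//; apply: sumZ_norm_le (abs_cvgZZ 4 cw) => c.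
  rewrite /w !normrM (ger0_norm (exprn_ge0 _ (expR_ge0 _))).
  rewrite [leRHS]mulrCA ler_wpM2l//.
have near (s : R) c : `|s| = 2^-1 -> (`|(b - c)%R| <= `|c|)%N ->
    `|(atgrid h (psim n.+1) + s *: g) (b - c)| <= 4 * expR h ^+ `|c|%N.
  move=> s2 bc; rewrite gE !fctE /GRing.scale /= /atgrid.
  apply: (le_trans (ler_normD _ _)); rewrite [`|s * _|]normrM s2 norm_odd_part//.
  have := psim_le_expR (h * (b - c)%:~R) n3; rewrite expR_norm_grid// => p1.
  have : expR h ^+ `|(b - c)%R|%N <= expR h ^+ `|c|%N.
    by rewrite ler_weXn2l// ltW// expR_gt1.
  by lra.
have far (s : R) c : b != c -> s * Num.sg ((b - c)%:~R : R) = - 2^-1 ->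
    `|(atgrid h (psim n.+1) + s *: g) (b - c)| <= 4 * expR h ^+ `|c|%N.
  move=> bc s2; rewrite gE !fctE /GRing.scale /= /atgrid psim_taylor.
  rewrite sgrM gtr0_sg// mul1r; move: (_ - _.[_]) => G.
  have sg2 : Num.sg ((b - c)%:~R : R) ^+ 2 = 1.
    by rewrite sqr_sg intr_eq0 subr_eq0 bc.
  have -> : Num.sg ((b - c)%:~R : R) / 2 * G + s * G = 0.
    have -> : s = - 2^-1 * Num.sg ((b - c)%:~R : R).
      by rewrite -s2 -mulrA -expr2 sg2 mulr1.
    by field.
  by rewrite normr0 mulr_ge0 ?exprn_ge0 ?expR_ge0.
have [b0|b0] := leP 0 b.
- apply: (half (- 2^-1)) => c; have [bc|bc] := ltP 0 (b - c).
    apply: far; first by lia.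
    by rewrite gtr0_sg ?mulr1// ltr0z.
  by apply: near; [rewrite normrN ger0_norm|lia].
- apply: (half 2^-1) => c; have [bc|bc] := ltP (b - c) 0.
    apply: far; first by lia.
    by rewrite ltr0_sg ?mulrN1// ltrz0.
  by apply: near; [rewrite ger0_norm|lia].
Qed.

(** The difference with the unit impulse is bounded and killed by the factors
    [T - t]. *)
Lemma conv_psim (b : int) : zconv_cvg D (atgrid h (psim n.+1)) b ->
  zconv D (atgrid h (psim n.+1)) = delta0 R.
Proof.
move=> /conv_psim_weight cD; have [M vM] := conv_psim_bounded cD.
have cpsi := conv_growth_expR cD (fun x => psim_le_expR x n3).
apply/eqP; rewrite -subr_eq0; apply/eqP.
apply: (@act_prod_inj _ ts 1 (M + 1)) => //.
- by move=> t /ts_lt t2; rewrite ltr0_norm; lra.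
- move=> b'; rewrite expr1n mulr1 !fctE; apply: (le_trans (ler_normB _ _)).
  by rewrite lerD// /delta0; case: eqP; rewrite ?normr1 ?normr0.
- by rewrite actBr conv_symbol// symbol_psim// QE actZ scalerK// subrr.
Qed.

End Convolutions.

Theorem theorem3 (R : realType) (h : R) (m : nat)
    (h_gt0 : 0 < h) (m123 : (1 <= m <= 3)%N) :
  (* 1 *)
  (forall b : int, zconv_cvg (Dm h m) (atgrid h (fun x => expR x)) b ->
     zconv (Dm h m) (atgrid h (fun x => expR x)) b = 0) /\
  (* 2 *)
  (forall b : int, zconv_cvg (Dm h m) (atgrid h (fun x => expR (- x))) b ->
     zconv (Dm h m) (atgrid h (fun x => expR (- x))) b = 0) /\
  (* 3, for powers and for polynomials *)
  (forall (n : nat) (b : int), (n + 3 <= 2 * m)%N ->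
     zconv_cvg (Dm h m) (atgrid h (fun x => x ^+ n)) b /\
     zconv (Dm h m) (atgrid h (fun x => x ^+ n)) b = 0) /\
  (forall (q : {poly R}) (b : int), (size q <= 2 * m - 2)%N ->
     zconv_cvg (Dm h m) (atgrid h (fun x => q.[x])) b /\
     zconv (Dm h m) (atgrid h (fun x => q.[x])) b = 0) /\
  (* 4 *)
  (forall b : int, zconv_cvg (Dm h m) (atgrid h (psim m)) b ->
     zconv (Dm h m) (atgrid h (psim m)) b = (b == 0)%:R) /\
  (* the convolutions in 1, 2 and 4 exist when each inner root l satisfies
     |l| e^h < 1, in particular for m = 1 *)
  ((forall l : R[i], l \in inner_roots h m -> `|l| * (expR h)%:C < 1) ->
     forall b : int,
       [/\ zconv_cvg (Dm h m) (atgrid h (fun x => expR x)) b,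
           zconv_cvg (Dm h m) (atgrid h (fun x => expR (- x))) b &
           zconv_cvg (Dm h m) (atgrid h (psim m)) b]).
Proof.
case: m m123 => [|n]//= n3.
have [k [ts [k0 sts uts tslt QE]]] := Qpoly_split h_gt0 (n3 : (1 <= n.+1 <= 3)%N).
have conv_q (q : {poly R}) (b : int) : (size q <= 2 * n.+1 - 2)%N ->
    zconv_cvg (Dm h n.+1) (atgrid h (fun x => q.[x])) b /\
    zconv (Dm h n.+1) (atgrid h (fun x => q.[x])) b = 0.
  move=> sq; apply: (conv_poly h_gt0 n3 k0 sts uts tslt QE); lia.
split=> [b cb|]; first by rewrite (conv_expR n3 k0 sts uts tslt QE cb).2.
split=> [b cb|]; first by rewrite (conv_expRN n3 k0 sts uts tslt QE cb).2.
split=> [j b jn|].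
  have -> : atgrid h (fun x => x ^+ j) = atgrid h (fun x => ('X^j).[x]).
    by apply/funext => c; rewrite /atgrid hornerXn.
  by apply: conv_q; rewrite size_polyXn; lia.
split=> //; split=> [b cb|inner1 b].
  by rewrite (conv_psim h_gt0 n3 k0 sts uts tslt QE cb).
have lE t : t \in ts -> `|small_root t| * expR h < 1.
  move=> tts; rewrite -ltcR rmorphM /=.
  have lin : (small_root t)%:C \in inner_roots h n.+1.
    rewrite (perm_mem (inner_roots_split n3 k0 sts tslt QE)).
    by rewrite !map_f.
  by have := inner1 _ lin; rewrite normc_def /= expr0n addr0 sqrtr_sqr.
have cD := Dm_weight n3 k0 sts uts tslt QE (expR_ge0 h) lE.
split.
- apply: (conv_growth_expR h_gt0 (M := 1)) => // x.
  by rewrite mul1r ger0_norm ?expR_ge0// ler_expR ler_norm.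
- apply: (conv_growth_expR h_gt0 (M := 1)) => // x.
  by rewrite mul1r ger0_norm ?expR_ge0// ler_expR -normrN ler_norm.
- by apply: (conv_growth_expR h_gt0 cD) => x; exact: psim_le_expR.
Qed.
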